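(* Let $n\ge d\ge 2$. The multiplex $M^{d,n}$ has the same flag vector as the $(d-2)$-fold pyramid over the $(n-d+3)$-gon. For every $S=\{s_1,s_2,\ldots,s_r\}\subseteq\{0,1,\ldots,d-1\}$ with $s_1<s_2<\cdots<s_r$, and with $s_{r+1}=d$, the common flag vector is given by $$f_S=\binom{d+1}{s_1+1,\ s_2-s_1,\ \ldots,\ s_r-s_{r-1},\ d-s_r}\left[1+\frac{n-d}{(d+1)d(d-1)}\sum_{j=1}^r (s_j+1)(s_{j+1}-s_j)(s_{j+1}-1)\right].$$
   Context: A $d$-dimensional multiplex is a $d$-dimensional convex polytope with an ordered list of vertices $x_0,x_1,\ldots,x_n$ whose facets are exactly $F_0,F_1,\ldots,F_n$, where $F_i=\mathrm{conv}\{x_{i-d+1},x_{i-d+2},\ldots,x_{i-1},x_{i+1},x_{i+2},\ldots,x_{i+d-1}\}$, with the conventions that $x_j=x_0$ if $j<0$ and $x_j=x_n$ if $j>n$. For all $n\ge d\ge 2$, such a polytope exists (a known result), and its face lattice is determined by $d$ and $n$; $M^{d,n}$ denotes the $d$-dimensional multiplex with $n+1$ vertices. For a $d$-polytope $P$ and $S\subseteq\{0,1,\ldots,d-1\}$, an $S$-flag is a chain of faces $\emptyset\subset F_1\subset F_2\subset\cdots\subset F_r\subset P$ with $S=\{\dim F_1,\ldots,\dim F_r\}$. The number of $S$-flags is $f_S(P)$, and the flag vector of $P$ is $(f_S(P))_{S\subseteq\{0,1,\ldots,d-1\}}$. The symbol $\binom{N}{a_1,\ldots,a_t}$ is the multinomial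 coefficient $N!/(a_1!\cdots a_t!)$; for $S=\emptyset$ it is read as $1$ and the sum is empty, so $f_\emptyset=1$. The $t$-fold pyramid over a polytope is obtained by taking the pyramid $t$ times in succession. *)

(* Defs.v *)
From HB Require Import structures.
From mathcomp Require Import all_boot all_order all_algebra finmap.
From mathcomp Require Import all_classical all_reals.

Set Implicit Arguments.
Unset Strict Implicit.
Unset Printing Implicit Defensive.

Import Order.TTheory GRing.Theory Num.Theory.
Local Open Scope classical_set_scope.
Local Open Scope ring_scope.

Section Polytopes.
Variables (R : realType) (N : nat).
Local Notation E := 'rV[R]_N.
Implicit Types (A P B F : set E).

Definition aff A : set E :=
  [set x | exists m (p : 'I_m -> E) (w : 'I_m -> R),
    [/\ forall i, A (p i), \sum_i w i = 1 & x = \sum_i w i *: p i]].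

Definition conv A : set E :=
  [set x | exists m (p : 'I_m -> E) (w : 'I_m -> R),
    [/\ forall i, A (p i), forall i, 0 <= w i, \sum_i w i = 1
      & x = \sum_i w i *: p i]].

(* The affine hull of A is a translate of a k-dimensional linear subspace;
   the empty set has no dimension in this sense. *)
Definition has_dim A (k : nat) : Prop :=
  exists (U : {vspace E}) (x0 : E),
    \dim U = k /\ aff A = [set x0 + u | u in [set` U]].

Definition polytope P : Prop := exists2 A, finite_set A & P = conv A.

(* The case c = 0 makes set0 (b = 1) and P itself (b = 0) faces. *)
Definition face P F : Prop :=
  exists (c : 'cV[R]_N) (b : R),
    (forall x, P x -> (x *m c) 0 0 <= b) /\
    F = P `&` [set x | (x *m c) 0 0 = b].

Definition faces_of_dim P (k : nat) : set (set E) :=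
  [set F | face P F /\ has_dim F k].

Definition vertices P : set E := [set x | face P [set x]].

(* The order on sets is inclusion: the path condition says that
   set0, the members of the flag, and P are successively strictly included. *)
Definition flags (d : nat) P (S : {set 'I_d}) : set (seq (set E)) :=
  [set Fs | [/\ path <%O set0 (rcons Fs P),
                forall F, F \in Fs -> face P F
              & [set k | exists2 F, F \in Fs & has_dim F k] =
                [set nat_of_ord i | i in [set` S]]]].

(* fset_set is empty on infinite sets, but a polytope has finitely many flags. *)
Definition flag_vector (d : nat) P (S : {set 'I_d}) : nat :=
  #|` fset_set (flags P S)|.

Definition pyramid B P : Prop :=
  exists2 a, ~ aff B a & P = conv (B `|` [set a]).

Fixpoint pyramid_iter (t : nat) B P : Prop :=
  if t is t'.+1 then exists2 P', pyramid_iter t' B P' & pyramid P' P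
  else P = B.

Definition polygon (k : nat) P : Prop :=
  [/\ polytope P, has_dim P 2 & (vertices P #= `I_k)%card].

End Polytopes.

(* Truncation of an integer index to {0, ..., n}. *)
Definition clamp (n : nat) (j : int) : 'I_n.+1 :=
  inord (minn n `|Num.max j 0|%N).

Definition multiplex (R : realType) (N d n : nat) (P : set 'rV[R]_N) : Prop :=
  [/\ polytope P, has_dim P d &
    exists x : 'I_n.+1 -> 'rV[R]_N,
      [/\ injective x, vertices P = range x &
          faces_of_dim P d.-1 =
          range (fun i : 'I_n.+1 =>
            conv [set x (clamp n j) | j in
              [set j : int | [/\ i%:Z - d%:Z + 1 <= j, j <= i%:Z + d%:Z - 1
                               & j != i%:Z]]])]].

Definition multinomial (m : nat) (a : seq nat) : rat :=
  m`!%:R / (\prod_(k <- a) k`!)%N%:R.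

(* For s = [:: s_1; ...; s_r] this is the value given for f_S; as s`_j counts
   from 0, the paper's s_(j+1) is t`_j below, with t`_r = d.  The multinomial
   entries s_1 + 1, s_2 - s_1, ..., d - s_r are the successive differences of
   0, s_1 + 1, ..., s_r + 1, d + 1; for r = 0 this is the single entry d + 1. *)
Definition flag_formula (d n : nat) (s : seq nat) : rat :=
  let t := rcons s d in
  multinomial d.+1 (pairmap (fun a b => b - a)%N 0%N [seq k.+1 | k <- t]) *
  (1 + (n%:R - d%:R) / ((d%:R + 1) * d%:R * (d%:R - 1)) *
       \sum_(j < size s)
          ((nth 0%N t j)%:R + 1)
          * ((nth 0%N t j.+1)%:R - (nth 0%N t j)%:R)
          * ((nth 0%N t j.+1)%:R - 1)).

(* Main.v *)
Require Import Defs.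
From mathcomp Require Import all_boot all_order all_algebra finmap.
From mathcomp Require Import all_classical all_reals.
From mathcomp Require Import zify ring lra.

Set Implicit Arguments.
Unset Strict Implicit.
Unset Printing Implicit Defensive.

Import Order.TTheory GRing.Theory Num.Theory.

(* Faces of a polytope are identified with the sets of generating points they
   contain.  Call a graded family of such sets multiplicial when there is a
   nonnegative excess e on its members such that a member X of rank k (rank =
   dimension + 1) contains C(k,r) + e(X) C(k-2,r-1) members of rank r > 0, whose
   excesses add up to e(X) C(k-3,r-3).  This is hereditary, so descending
   induction along flags expresses every flag number as an affine function of
   the excess of the whole polytope, the same for all multiplicial families.
   Pascal's rule shows that pyramids preserve the property, and a polygon with
   e+3 vertices has it with excess e.
     For the multiplex, the vertex sets of faces are the intersections of the
   given facets.  Collapsing the edge {0,1} maps the sets for (d,n+1) to those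
   for (d,n); it is a rank-preserving bijection away from the subsets of the
   simplex facet F_0 = {0..d-1}, which contains all its subsets, and this gives
   the counts by induction on n from the d-simplex.  The geometric dimension is
   recovered from the combinatorial rank because dimension is strictly
   increasing on faces and every face lies on a chain of maximal length. *)
Local Open Scope nat_scope.

(** The binomials [C(k-2,r-1)] and [C(k-3,r-3)] come from the collapse. A member X of rank k
    containing 0 and 1 but not lying in [F_0] keeps its rank and loses one point, so its excess is
    one more than that of its image. Such an X meets [F_0] in k-1 points and its image meets
    {0..d-2} in k-2 points; below X and below the image only these Boolean parts differ, which gives
    [C(k-1,r) - C(k-2,r) = C(k-2,r-1)] new members of rank r. Among the members below X, those of
    the same kind are determined by their trace on [F_0], which is any subset of the trace of X
    containing 0 and 1: there are [C(k-3,r-3)] of them in rank r, and each contributes one to the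
    sum of excesses. The obstacle is that only the list of facets is given. Rank, strict
    monotonicity and saturated chains must therefore be established for the bare intersections of
    facets before a polytope enters. The collapse also fails to be injective inside [F_0], so each
    statement about it has a Boolean case and a case away from [F_0]. *)

Section FaceLattices.
(* Both fintype/finset and classical_sets define subsetP, set0, setP, ...: the
   unqualified names below are those of the finite versions. *)
Import mathcomp.boot.fintype mathcomp.boot.finset.

(** * Graded families of sets *)

Section GradedFamily.
Variables (T : finType) (L : {set {set T}}) (rk : {set T} -> nat).

Definition lower (X : {set T}) (r : nat) := [set Y in L | (Y \subset X) && (rk Y == r)].

(** Ranks are listed from the top downwards. Inclusions are weak; they become strict as soon as the
    ranks strictly decrease. *)
Fixpoint nchains (X : {set T}) s :=
  if s is r :: s' then \sum_(Y in lower X r) nchains Y s' else 1.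

(* For members that are faces of polytopes, e X is the number of vertices of X
   minus its rank; the shape of the counts is that of a pyramid over a polygon. *)
Definition multiplicial (e : {set T} -> nat) := forall X : {set T}, X \in L ->
  [/\ #|lower X 0| = 1,
      forall r, #|lower X r.+1| = 'C(rk X, r.+1) + e X * 'C(rk X - 2, r),
      forall r, \sum_(Y in lower X r.+3) e Y = e X * 'C(rk X - 3, r)
    & 0 < e X -> 2 < rk X].

End GradedFamily.

Fixpoint simplex_flags k s :=
  if s is r :: s' then 'C(k, r) * simplex_flags r s' else 1.

(** Coefficient of the excess in the number of chains. The factor [2 < r] guards against truncation:
    members of rank at most 2 have no excess, whereas ['C(k - 3, r - 3)] would be 1 there. *)
Fixpoint excess_flags k s :=
  if s is r :: s' then
    'C(k - 2, r.-1) * simplex_flags r s' +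
    (2 < r) * 'C(k - 3, r - 3) * excess_flags r s'
  else 0.

Lemma nchains_multiplicial (T : finType) (L : {set {set T}}) rk e X s :
  multiplicial L rk e -> X \in L -> all (leq 1) s ->
  nchains L rk X s = simplex_flags (rk X) s + e X * excess_flags (rk X) s.
Proof.
move=> gL; elim: s X => [|r s IHs] X XL /=; first by rewrite muln0.
case/andP=> r_gt0 s_gt0.
have -> : \sum_(Y in lower L rk X r) nchains L rk Y s =
    #|lower L rk X r| * simplex_flags r s +
    (\sum_(Y in lower L rk X r) e Y) * excess_flags r s.
  rewrite -sum1_card !big_distrl -big_split /=; apply: eq_bigr => Y.
  by rewrite !inE => /and3P[YL _ /eqP<-]; rewrite IHs// mul1n.
have [_ cardX sumX _] := gL X XL.
case: r r_gt0 {IHs} => // r _; rewrite cardX /=.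
case: (leqP 3 r.+1) => [r_gt2|r_lt3].
  have := sumX (r - 2); have -> : (r - 2).+3 = r.+1 by lia.
  by move=> ->; rewrite (_ : r.+1 - 3 = r - 2); lia.
rewrite [\sum_(Y in _) e Y]big1; first by lia.
move=> Y; rewrite !inE => /and3P[YL _ /eqP rkY]; have [_ _ _] := gL Y YL.
by rewrite rkY; lia.
Qed.

Section Pyramid.
Variables (T : finType) (L : {set {set T}}) (rk e : {set T} -> nat).

Definition pyr_base (Z : {set option T}) : {set T} := Some @^-1: Z.
(** [None] is the apex: a face of a pyramid is a face of the base, with or without the apex. *)
Definition pyr_sets : {set {set option T}} := [set Z | pyr_base Z \in L].
Definition pyr_rank (Z : {set option T}) := rk (pyr_base Z) + (None \in Z).

(** A subset of [option T] is a pair of a Boolean and a subset of [T]. With the apex the base has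
    rank [r - 1], and the factor [0 < r] corrects the truncated predecessor at rank 0. *)
Lemma sum_lower_pyramid (X : {set option T}) (r : nat) (F : {set T} -> nat) :
  \sum_(Y in lower pyr_sets pyr_rank X r) F (pyr_base Y) =
  \sum_(Y in lower L rk (pyr_base X) r) F Y +
  ((None \in X) && (0 < r)) * \sum_(Y in lower L rk (pyr_base X) r.-1) F Y.
Proof.
pose glue (q : bool * {set T}) : {set option T} :=
  if q.1 then None |: (Some @: q.2) else Some @: q.2.
have baseG q : pyr_base (glue q) = q.2.
  apply/setP=> t; rewrite !inE /glue; case: q.1; rewrite ?inE /= mem_imset//;
  exact: Some_inj.
have noneG q : (None \in glue q) = q.1.
  rewrite /glue; case: q.1; rewrite ?inE //=; apply/negbTE/imsetP => -[] //.
have glueK : cancel (fun Y : {set option T} => (None \in Y, pyr_base Y)) glue.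
  move=> Y; apply/setP=> -[t|].
    have := baseG (None \in Y, pyr_base Y) => /setP/(_ t).
    by rewrite !inE /= => ->.
  by rewrite noneG.
rewrite (reindex glue) /=; last first.
  exists (fun Y : {set option T} => (None \in Y, pyr_base Y)) => [[b q] _|Y _]; last exact: glueK.
  by rewrite noneG baseG.
rewrite (eq_bigl (fun q => (if q.1 then (None \in X) && (0 < r) else true)
   && (q.2 \in lower L rk (pyr_base X) (if q.1 then r.-1 else r)))); last first.
  case=> b Y; rewrite !inE /pyr_rank baseG noneG /=.
  have -> : (glue (b, Y) \subset X) = (b ==> (None \in X)) && (Y \subset pyr_base X).
    apply/idP/andP => [/fintype.subsetP sub|[bX /fintype.subsetP sub]].
      split; first by apply/implyP=> bt; apply: sub; rewrite noneG.
      by apply/fintype.subsetP=> t tY; rewrite inE; apply: sub;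
         have /setP/(_ t) := baseG (b, Y); rewrite inE tY.
    apply/fintype.subsetP=> -[t|]; last by rewrite noneG /= => bt; move: bX; rewrite bt.
    have /setP/(_ t) := baseG (b, Y); rewrite inE => -> /sub.
    by rewrite inE.
  case: b => /=; last by rewrite addn0.
  rewrite addn1; case: r => [|r] /=; first by rewrite !andbF.
  by rewrite eqSS andbT -andbA andbCA.
under eq_bigr do rewrite baseG.
rewrite -(pair_big_dep (fun b : bool => if b then (None \in X) && (0 < r) else true) 
  (fun b Y => Y \in lower L rk (pyr_base X) (if b then r.-1 else r)) (fun _ Y => F Y)) /=.
rewrite big_mkcond big_bool /= addnC; congr (_ + _).
by case: ifP => _; rewrite ?mul1n.
Qed.

Lemma multiplicial_pyramid : multiplicial L rk e ->
  multiplicial pyr_sets pyr_rank (e \o pyr_base).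
Proof.
move=> gL X; rewrite inE => XL.
have [card0 cardX sumX e_gt0] := gL _ XL.
have cardP r : #|lower pyr_sets pyr_rank X r| =
    #|lower L rk (pyr_base X) r| +
    ((None \in X) && (0 < r)) * #|lower L rk (pyr_base X) r.-1|.
  by rewrite -!sum1_card (sum_lower_pyramid _ _ (fun=> 1)).
(* Needed for the lowest sum: joining the apex to a base member of rank 2 gives a member of rank 3,
   without excess. *)
have e2 : \sum_(Y in lower L rk (pyr_base X) 2) e Y = 0.
  apply: big1 => Y; rewrite !inE => /and3P[YL _ /eqP rkY].
  by have [_ _ _] := gL Y YL; rewrite rkY; lia.
rewrite (_ : pyr_rank X = rk (pyr_base X) + (None \in X))// /=.
set k := rk _ in card0 cardX sumX e_gt0 *.
set E := e _ in cardX sumX e_gt0 *.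
clearbody k E.
(* Pascal's rule for [k - 2] and [k - 3] breaks down where subtraction truncates. The last clause of
   [multiplicial] excludes this: positive excess forces [k >= 3]. *)
have [E0|[m km]] : E = 0 \/ exists m, k = m.+3.
- by case: (posnP E) => [|/e_gt0 kgt]; [left | right; exists (k - 3); lia].
- subst E; split=> // [|r|r]; rewrite ?cardP ?sum_lower_pyramid ?card0 ?andbF//.
  + rewrite cardX !mul0n !addn0 andbT; case: (None \in X); last by rewrite mul0n !addn0.
    rewrite mul1n addn1 /=; case: r => [|r]; first by rewrite card0 !bin1 addn1.
    by rewrite cardX !mul0n addn0 binS.
  + by rewrite sumX; case: r => [|r] /=; rewrite ?e2 ?sumX !mul0n ?muln0.
- subst k; split=> [|r|r|/e_gt0]; last by lia.
  + by rewrite cardP card0 andbF.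
  + rewrite cardP cardX /= andbT; case: (None \in X); last by rewrite mul0n !addn0.
    rewrite mul1n [m.+3 + _]addn1 (_ : m.+3 - 2 = m.+1) 1?(_ : m.+4 - 2 = m.+2)//.
    case: r => [|r]; first by rewrite card0 !bin1 !bin0; lia.
    by rewrite cardX (_ : m.+3 - 2 = m.+1)// (binS m.+3) (binS m.+1); lia.
  + rewrite !sum_lower_pyramid sumX /= andbT.
    case: (None \in X); last by rewrite mul0n !addn0.
    rewrite mul1n [m.+3 + _]addn1 (_ : m.+4 - 3 = m.+1)// (_ : m.+3 - 3 = m); last by lia.
    case: r => [|r]; first by rewrite e2 !bin0 addn0.
    by rewrite sumX (_ : m.+3 - 3 = m) ?binS; lia.
Qed.
End Pyramid.

(** * The closed formula *)

Local Notation ranks s := (rev [seq k.+1 | k <- s]).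

Lemma sorted_ltn_rcons s d : sorted ltn s -> (forall k, k \in s -> k < d) ->
  sorted ltn (rcons s d).
Proof.
case: s => //= a s sa s_lt; rewrite rcons_path sa.
by apply: s_lt; rewrite mem_last.
Qed.

(** After multiplication by the factorials, removing the largest entry [r] amounts to
    [(k+1)! = C(k+1,r+1) (r+1)! (k-r)!], which splits off the last multinomial entry. *)
Lemma simplex_flags_multinomial k s : sorted ltn (rcons s k) ->
  ((simplex_flags k.+1 (ranks s))%:R)%R =
  multinomial k.+1 (pairmap (fun a b => b - a) 0 [seq i.+1 | i <- rcons s k]).
Proof.
move=> st; set g := pairmap _ _ _.
suff simplexM : simplex_flags k.+1 (ranks s) * \prod_(a <- g) a`! = k.+1`!.
  rewrite /multinomial -simplexM natrM mulfK// pnatr_eq0 -lt0n.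
  by apply: prodn_gt0 => a; rewrite fact_gt0.
rewrite {}/g; elim/last_ind: s k st => [|s r IHs] k st.
  by rewrite /= big_seq1 subn0 mul1n.
have [rs_sorted r_lt_k] : sorted ltn (rcons s r) /\ r < k.
  by move: st; case: s {IHs} => [|a s] /=; rewrite ?andbT// rcons_path last_rcons => /andP[].
rewrite !map_rcons rev_rcons /= -(cats1 (rcons _ _) k.+1) pairmap_cat big_cat /=.
rewrite big_seq1 last_rcons -map_rcons subSS mulnACA mulnC -mulnA.
have <- := @bin_fact k.+1 r.+1 (ltnW r_lt_k); rewrite subSS -(IHs r rs_sorted).
set P := \prod_(_ <- _) _; set F := simplex_flags _ _; ring.
Qed.

Local Open Scope ring_scope.

Definition excess_sum (s : seq nat) (k : nat) : rat :=
  let t := rcons s k in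
  \sum_(j < size s) ((nth 0%N t j)%:R + 1)
    * ((nth 0%N t j.+1)%:R - (nth 0%N t j)%:R) * ((nth 0%N t j.+1)%:R - 1).

Lemma excess_sum_rcons s r k :
  excess_sum (rcons s r) k =
  excess_sum s r + (r%:R + 1) * (k%:R - r%:R) * (k%:R - 1).
Proof.
rewrite /excess_sum size_rcons big_ord_recr /=; congr (_ + _).
  apply: eq_bigr => j _; have jlt := ltn_ord j.
  by rewrite !(nth_rcons _ (rcons s r)) size_rcons !ltnS jlt (ltnW jlt).
by rewrite !(nth_rcons _ (rcons s r)) size_rcons ltnS leqnn ltnn eqxx nth_rcons ltnn eqxx.
Qed.

(** Stated without division because [(k+1)k(k-1)] vanishes for [k <= 1], and such values are reached
    when the induction descends to small entries of [s]. For the largest entry [r], the first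
    summand of [excess_flags] yields the new term of [excess_sum], and the second converts the
    factor at [k] into the one at [r]. *)
Lemma excess_flagsE k s : sorted ltn (rcons s k) ->
  (excess_flags k.+1 (ranks s))%:R * ((k%:R + 1) * k%:R * (k%:R - 1)) =
  (simplex_flags k.+1 (ranks s))%:R * excess_sum s k :> rat.
Proof.
elim/last_ind: s k => [|s r IHs] k st.
  by rewrite /= /excess_sum big_ord0 mulr0 mul0r.
have [rs_sorted r_lt_k] : sorted ltn (rcons s r) /\ (r < k)%N.
  by move: st; case: s {IHs} => [|a s] /=; rewrite ?andbT// rcons_path last_rcons => /andP[].
rewrite map_rcons rev_rcons /= excess_sum_rcons.
have {IHs} := IHs r rs_sorted; set E := excess_flags _ _; set F := simplex_flags _ _.
set S := excess_sum s r => IH; clearbody E F S.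
case: k r_lt_k {st} => // k; rewrite ltnS => r_le_k.
rewrite !subSS subn0 ltnS.
have bin1 : 'C(k, r)%:R * ((k.+1%:R + 1) * k.+1%:R) =
   'C(k.+2, r.+1)%:R * (r%:R + 1) * (k.+1%:R - r%:R) :> rat.
  have e1 := mul_bin_down k.+1 r; have e2 := mul_bin_diag k.+2 r.
  have: ('C(k, r) * (k.+2 * k.+1) = 'C(k.+2, r.+1) * r.+1 * (k.+1 - r))%N.
    by rewrite /= in e1 e2; rewrite -[RHS]mulnA; nia.
  move=> /(congr1 (fun m : nat => m%:R : rat)); rewrite !natrM natrB; last by lia.
  by rewrite -!natr1.
have bin3 : ((1 < r) * 'C(k - 1, r - 2))%N%:R * ((k.+1%:R + 1) * k.+1%:R * (k.+1%:R - 1)) * E%:R =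
   'C(k.+2, r.+1)%:R * (F%:R * S) :> rat.
  (* For [r <= 1] the guard annihilates the left side and [(r+1)r(r-1) = 0] the right side. *)
  rewrite -IH; case: (ltnP 1 r) => [r_gt1|r_le1]; last first.
    by case: r r_le1 {IH bin1 rs_sorted r_le_k} => [|[|]]//= _; rewrite ?subrr; ring.
  case: r r_gt1 r_le_k {IH bin1 rs_sorted} => [|[|r]]// _; case: k => // k _.
  rewrite !subSS !subn0 mul1n.
  have e1 := mul_bin_diag k.+1 r; have e2 := mul_bin_diag k.+2 r.+1.
  have e3 := mul_bin_diag k.+3 r.+2.
  have: ('C(k, r) * (k.+3 * k.+2 * k.+1) = 'C(k.+3, r.+3) * (r.+3 * r.+2 * r.+1))%N.
    rewrite /= in e1 e2 e3.
    have -> : ('C(k, r) * (k.+3 * k.+2 * k.+1) = k.+3 * (k.+2 * (k.+1 * 'C(k,r))))%N by ring.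
    by rewrite e1 (mulnCA k.+2) e2 !(mulnCA k.+3) e3; ring.
  move=> /(congr1 (fun m : nat => m%:R : rat)); rewrite !natrM -!natr1 => h.
  set c := 'C(_, _)%:R in h *; set c' := 'C(_, _)%:R in h *.
  set x : rat := k%:R in h *; set y : rat := r%:R in h *.
  transitivity (c * ((x + 1 + 1 + 1) * (x + 1 + 1) * (x + 1)) * E%:R); first by ring.
  by rewrite h; ring.
rewrite natrD mulrDl [S + _]addrC [RHS]mulrDr; congr (_ + _).
  rewrite !natrM -/F.
  transitivity ('C(k, r)%:R * ((k.+1%:R + 1) * k.+1%:R) * (k.+1%:R - 1) * F%:R : rat).
    by ring.
  by rewrite bin1; ring.
by rewrite (natrM _ (_ * _)%N E) [X in _ = X * _]natrM -[RHS]mulrA -bin3; ring.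
Qed.

Lemma flag_formulaE d n s : (2 <= d)%N -> (d <= n)%N -> sorted ltn (rcons s d) ->
  (simplex_flags d.+1 (ranks s) + (n - d) * excess_flags d.+1 (ranks s))%N%:R =
  flag_formula d n s.
Proof.
move=> d2 dn st; rewrite /flag_formula -simplex_flags_multinomial//.
rewrite -/(excess_sum s d) mulrDr mulr1 natrD natrM natrB//; congr (_ + _).
have := excess_flagsE st; set D := (_ + 1) * _ * _ => ED.
have D0 : D != 0.
  rewrite (_ : D = (d.+1 * d * (d - 1))%N%:R) ?pnatr_eq0; first by lia.
  by rewrite /D !natrM natrB ?natr1 ?(ltnW d2).
by rewrite mulrCA -ED; field.
Qed.

(** * Vertex sets of faces of multiplexes *)

Local Open Scope nat_scope.

(* The diagonal cases i = 0 and i = n come from the truncated indices x_{-1} = x_0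
   and x_{n+1} = x_n in F_0 and F_n. *)
Definition adjacent d n (i j : nat) : bool :=
  [&& i != j, i < j + d & j < i + d] || (i == j) && ((i == 0) || (i == n)).

Definition mfacet d n (i : 'I_n.+1) : {set 'I_n.+1} := [set j : 'I_n.+1 | adjacent d n i j].

(* X is an intersection of facets: every point outside X is cut off by some
   facet containing X. *)
Definition msets d n : {set {set 'I_n.+1}} :=
  [set X : {set 'I_n.+1} | [forall t, (t \notin X) ==>
    [exists i, (X \subset mfacet d i) && (t \notin mfacet d i)]]].

Lemma msetsP d n (X : {set 'I_n.+1}) :
  reflect (forall t, t \notin X ->
             exists2 i, X \subset mfacet d i & t \notin mfacet d i)
          (X \in msets d n).
Proof.
rewrite inE; apply: (iffP forallP) => [XL t tX|XL t].
  have /implyP/(_ tX)/existsP[i /andP[Xi ti]] := XL t.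
  by exists i.
apply/implyP=> /XL[i Xi ti]; apply/existsP; exists i; exact/andP.
Qed.

Definition init n m : {set 'I_n.+1} := [set j : 'I_n.+1 | j < m].

Definition collapse n (j : 'I_n.+2) : 'I_n.+1 := inord j.-1.

Lemma collapseE n (j : 'I_n.+2) : collapse j = j.-1 :> nat.
Proof. by rewrite /collapse inordK//; have := ltn_ord j; lia. Qed.

(* Defined along the collapse of {0,1} down to the simplex n = d; the subsets of
   F_0 are simplices. *)
Fixpoint mrank d n : {set 'I_n.+1} -> nat :=
  match n with
  | 0 => fun X => #|X|
  | m.+1 => fun X => if (m < d) || (X \subset init m.+1 d) then #|X|
                     else mrank d (@collapse m @: X)
  end.

Definition mexcess d n (X : {set 'I_n.+1}) := #|X| - mrank d X.

Definition ends n (X : {set 'I_n.+2}) : bool :=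
  (ord0 \in X) && (inord 1 \in X).

(** 0 and 1 are the only two points with a common image. *)
Lemma card_collapse n (X : {set 'I_n.+2}) :
  #|X| = #|@collapse n @: X| + ends X.
Proof.
have inj (Y : {set 'I_n.+2}) : ~~ ends Y -> #|@collapse n @: Y| = #|Y|.
  move=> nY; apply: card_in_imset => i j iY jY /(congr1 val).
  rewrite /= !collapseE => ij; apply: val_inj => /=.
  have [//|ne] := eqVneq (i : nat) j; exfalso; move/negP: nY; apply.
  have i0 (k : 'I_n.+2) : k = 0 :> nat -> k = ord0 by move=> k0; exact: val_inj.
  have i1 (k : 'I_n.+2) : k = 1 :> nat -> k = inord 1.
    by move=> k1; apply: val_inj; rewrite /= inordK.
  have [[/i0 ii /i1 jj]|[/i1 ii /i0 jj]] : (i = 0 :> nat /\ j = 1 :> nat) \/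
      (i = 1 :> nat /\ j = 0 :> nat) by lia.
    by rewrite /ends -ii -jj iY.
  by rewrite /ends -ii -jj iY jY.
have [/andP[X0 X1]|nX] := boolP (ends X); last by rewrite inj// addn0.
rewrite (cardsD1 ord0 X) X0 addnC -inj; last by rewrite /ends !inE eqxx.
congr (_ + _); apply: eq_card => t; apply/imsetP/imsetP => -[j].
  by rewrite !inE => /andP[_ jX] ->; exists j.
move=> jX ->; have [->|j0] := eqVneq j ord0; last by exists j => //; rewrite !inE j0.
exists (inord 1); last by apply: val_inj; rewrite /= !collapseE inordK.
by rewrite !inE X1 andbT -val_eqE /= inordK.
Qed.

Section Step.
Variables (d n : nat) (d2 : 2 <= d) (dn : d <= n).

Lemma mfacet0 : mfacet d (@ord0 n) = init n d.
Proof. by apply/setP=> j; rewrite !inE /adjacent /=; lia. Qed.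

(** A point t with 0 < t < d is the only point of [F_0] missed by [F_t], the point 0 is the only one
    missed by [F_d], and points outside [F_0] are cut off by [F_0] itself. *)
Lemma msets_init (X : {set 'I_n.+1}) : X \subset init n d -> X \in msets d n.
Proof.
move=> Xi; apply/msetsP=> t tX.
have [td|td] := leqP d t.
  by exists ord0; rewrite mfacet0// inE -leqNgt.
have Xlt j : j \in X -> j < d by move/(subsetP Xi); rewrite inE.
have [t0|t0] := posnP t.
  exists (inord d); last by rewrite inE inordK ?ltnS// /adjacent; lia.
  apply/subsetP => j jX; rewrite inE inordK ?ltnS//.
  have j0 : j != t :> nat by apply: contraNneq tX => /val_inj <-.
  by have := Xlt j jX; rewrite /adjacent; lia.
exists t; last by rewrite inE /adjacent; lia.
apply/subsetP => j jX; rewrite inE.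
have j0 : j != t :> nat by apply: contraNneq tX => /val_inj <-.
by have := Xlt j jX; rewrite /adjacent; lia.
Qed.

Lemma mrank_init (X : {set 'I_n.+1}) : X \subset init n d -> mrank d X = #|X|.
Proof. by case: n X dn => [|m] X dm //= ->; rewrite orbT. Qed.

End Step.

(** * The collapse of the edge {0,1}: from [n+1] to [n] *)

Section Contraction.
Variables (d n : nat) (d2 : 2 <= d) (dn : d <= n).
Local Notation L := (msets d n).
Local Notation L' := (msets d n.+1).
Local Notation pi := (@collapse n).
Local Notation small := (init n d.-1).
Local Notation small' := (init n.+1 d).

Lemma adjacent_collapse i j : 0 < i ->
  adjacent d n.+1 i j -> adjacent d n i.-1 j.-1.
Proof. by rewrite /adjacent; lia. Qed.

(** The collapse creates two incidences: [F_1] becomes [F_0], which contains its own index by the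
    diagonal convention, and [F_d], which contains 1, acquires 0 because 0 and 1 are identified.
    These exceptional pairs (1,1) and (d,0) shape the lemmas below. *)
Lemma adjacent_lift i j : 0 < i -> adjacent d n i.-1 j.-1 ->
  [|| adjacent d n.+1 i j, (i == 1) && (j == 1) | (i == d) && (j == 0)].
Proof. by rewrite /adjacent; lia. Qed.

Lemma mrank_big (X : {set 'I_n.+2}) : ~~ (X \subset small') ->
  mrank d X = mrank d (pi @: X).
Proof. by move=> /= /negbTE->; rewrite orbF ltnNge dn. Qed.

Lemma facet_gt0 (X : {set 'I_n.+2}) i :
  ~~ (X \subset small') -> X \subset mfacet d i -> 0 < i.
Proof.
move=> nX Xi; rewrite lt0n; apply: contraNneq nX => i0.
by rewrite -(mfacet0 d2 (leqW dn)); rewrite (_ : ord0 = i)//; apply: val_inj.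
Qed.

(** Facets [F_i] through such an X have i > 0. If [F_i] contains 0 then 0 < i < d, and it contains
    d; if it contains 1 then 1 < i <= d, and it contains d+1. *)
Lemma big_shift (X : {set 'I_n.+2}) (j t : 'I_n.+2) : X \in L' ->
  ~~ (X \subset small') -> j \in X -> j < 2 -> t = d + j :> nat -> t \in X.
Proof.
move=> /msetsP XL nX jX j2 tE; apply: contraT => /XL[i Xi].
have i0 := facet_gt0 nX Xi; have := subsetP Xi j jX.
by rewrite !inE tE /adjacent; lia.
Qed.

(** Suppose [F_i] contains Y and misses j in X, while the image of j lies in that of Y. Then (i,j)
    is an exceptional pair, X contains d+j by [big_shift], and so does Y, as d+j >= 2 is alone in
    its fibre; but [F_i] misses d+j. *)
Lemma collapse_subset (X Y : {set 'I_n.+2}) : X \in L' -> Y \in L' ->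
  ~~ (X \subset small') -> ~~ (Y \subset small') ->
  pi @: X \subset pi @: Y -> X \subset Y.
Proof.
move=> XL YL nX nY sXY; apply/subsetP => j jX; apply: contraT => jY.
have [i Yi ji] := msetsP _ _ YL j jY.
have i0 := facet_gt0 nY Yi.
have /imsetP[t tY /(congr1 val)] := subsetP sXY _ (imset_f pi jX).
rewrite /= !collapseE => jt.
have := subsetP Yi t tY; rewrite inE => it; move: ji; rewrite inE => ij.
have := adjacent_collapse i0 it; rewrite -jt => /(adjacent_lift i0).
rewrite (negbTE ij) /= => cs.
have j2 : j < 2 by case/orP: cs => /andP[_ /eqP->].
have dj : d + j < n.+2 by move: j2 dn; clear; lia.
have sX : Ordinal dj \in X by exact: (big_shift XL nX jX).
have /imsetP[s sY /(congr1 val)] := subsetP sXY _ (imset_f pi sX).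
rewrite /= !collapseE /= => sE.
have := subsetP Yi s sY; rewrite inE /adjacent.
by move: cs sE d2 dn; clear; lia.
Qed.

Lemma collapse_inj : {in [set X in L' | ~~ (X \subset small')] &,
  injective (fun X : {set 'I_n.+2} => pi @: X)}.
Proof.
move=> X Y /setIdP[XL nX] /setIdP[YL nY] /= XY.
apply/eqP; rewrite eqEsubset; apply/andP; split.
  by apply: (collapse_subset XL YL nX nY); rewrite XY.
by apply: (collapse_subset YL XL nY nX); rewrite XY.
Qed.

(** The bound drops from d to d-1 because 0 and 1 merge: the image of [F_0] is {0..d-2}, one point
    short of the simplex facet for [n]. *)
Lemma collapse_small (X : {set 'I_n.+2}) :
  (pi @: X \subset small) = (X \subset small').
Proof.
apply/subsetP/subsetP => [XS j jX|XS _ /imsetP[j jX ->]].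
  by have := XS _ (imset_f pi jX); rewrite !inE collapseE; lia.
by have := XS _ jX; rewrite !inE collapseE; lia.
Qed.

Lemma collapse_msets (X : {set 'I_n.+2}) : X \in L' -> ~~ (X \subset small') ->
  pi @: X \in L.
Proof.
move=> XL nX; apply/msetsP => t tX.
have sub i : X \subset mfacet d i -> pi @: X \subset mfacet d (pi i).
  move=> Xi; apply/subsetP => _ /imsetP[j jX ->].
  have := subsetP Xi j jX; rewrite !inE !collapseE.
  exact/adjacent_collapse/(facet_gt0 nX Xi).
have tX' (t' : 'I_n.+2) : t'.-1 = t -> t' \notin X.
  move=> t't; apply: contra tX => /(imset_f pi).
  by rewrite (_ : pi t' = t)//; apply: val_inj; rewrite /= collapseE.
have t1 : t.+1 < n.+2 by have := ltn_ord t; lia.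
have [i Xi ti] := msetsP _ _ XL (Ordinal t1) (tX' (Ordinal t1) erefl).
have i0 := facet_gt0 nX Xi.
(* For t > 0 the preimage is a single point outside all exceptional pairs. For t = 0 both 0 and 1
   are cut off, by [F_i'] and [F_i]; a collapsed facet still misses 0 unless i = 1 and i' = d, and
   [F_1] and [F_d] meet inside [F_0]. *)
have [t0|t0] := posnP t; last first.
  exists (pi i); first exact: sub.
  move: ti; rewrite !inE collapseE /=.
  by apply: contra => /(@adjacent_lift i t.+1 i0); lia.
have [i' Xi' ti'] := msetsP _ _ XL ord0 (tX' ord0 (esym t0)).
have i'0 := facet_gt0 nX Xi'.
have [i1|i1] := eqVneq (i : nat) 1; last first.
  exists (pi i); first exact: sub.
  by move: ti; rewrite !inE collapseE /= t0 /adjacent; lia.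
have [i'd|i'd] := eqVneq (i' : nat) d; last first.
  exists (pi i'); first exact: sub.
  by move: ti'; rewrite !inE collapseE /= t0 /adjacent; lia.
case/negP: nX; apply/subsetP => j jX; rewrite inE.
have := subsetP Xi j jX; have := subsetP Xi' j jX; rewrite !inE i1 i'd /adjacent.
lia.
Qed.

Lemma collapse_surj (X : {set 'I_n.+1}) : X \in L -> ~~ (X \subset small) ->
  exists X' : {set 'I_n.+2}, [/\ X' \in L', ~~ (X' \subset small') & pi @: X' = X].
Proof.
move=> XL nX.
have d1n : d.-1 < n.+1 by lia.
(* The full preimage minus what the exceptional pairs forbid: [F_0] lifts to [F_1], which misses 1,
   and [F_(d-1)] lifts to [F_d], which misses 0. Both points go only if X lies in the intersection
   of [F_0] and [F_(d-1)], which is {0..d-2} and is excluded. *)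
pose X' := [set j : 'I_n.+2 | [&& pi j \in X,
  ~~ ((j == 1 :> nat) && (X \subset mfacet d (@ord0 n))) &
  ~~ ((j == 0 :> nat) && (X \subset mfacet d (Ordinal d1n)))]].
have XX' : pi @: X' = X.
  apply/setP => t; apply/imsetP/idP => [[j]|tX].
    by rewrite inE => /and3P[jX _ _] ->.
  have [t0|t0] := posnP t; last first.
    have t1 : t.+1 < n.+2 by have := ltn_ord t; lia.
    have tE : pi (Ordinal t1) = t by apply: val_inj; rewrite /= collapseE.
    by exists (Ordinal t1) => //; rewrite inE tE tX /= (gtn_eqF (_ : 1 < t.+1)).
  have e1 : pi (inord 1) = t by apply: val_inj; rewrite /= collapseE inordK.
  have e0 : pi ord0 = t by apply: val_inj; rewrite /= collapseE.
  have [X0|X0] := boolP (X \subset mfacet d (@ord0 n)); last first.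
    by exists (inord 1) => //; rewrite inE e1 tX (negbTE X0) inordK.
  exists ord0 => //; rewrite inE e0 tX /=.
  apply: contra nX => X1; apply/subsetP => j jX.
  have := subsetP X0 j jX; have := subsetP X1 j jX; rewrite !inE /adjacent /=; lia.
have nX' : ~~ (X' \subset small') by rewrite -collapse_small XX'.
exists X'; split=> //; apply/msetsP => t tX'.
have sub (i : 'I_n.+2) : 0 < i -> X \subset mfacet d (pi i) -> X' \subset mfacet d i.
  move=> i0 Xi; apply/subsetP => j; rewrite inE => /and3P[jX j1 j0].
  have := subsetP Xi _ jX; rewrite !inE !collapseE => /(adjacent_lift i0).
  have i1 : i = 1 :> nat -> X \subset mfacet d (@ord0 n).
    by move=> i1; rewrite (_ : ord0 = pi i)//; apply: val_inj; rewrite /= collapseE i1.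
  have id : i = d :> nat -> X \subset mfacet d (Ordinal d1n).
    by move=> id; rewrite (_ : Ordinal d1n = pi i)//; apply: val_inj; rewrite /= collapseE id.
  case/or3P=> [//|/andP[/eqP/i1 E /eqP jE]|/andP[/eqP/id E /eqP jE]].
    by rewrite jE E in j1.
  by rewrite jE E in j0.
move: tX'; rewrite inE negb_and negb_and !negbK => /or3P[tX|/andP[/eqP t1 Xi]|/andP[/eqP t0 Xi]].
- have [i Xi ti] := msetsP _ _ XL _ tX.
  have i1 : i.+1 < n.+2 by have := ltn_ord i; lia.
  have iE : pi (Ordinal i1) = i by apply: val_inj; rewrite /= collapseE.
  exists (Ordinal i1); first by apply: sub; rewrite ?iE.
  apply: contra ti; rewrite !inE => /adjacent_collapse.
  by rewrite collapseE; apply.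
- exists (inord 1); last by rewrite inE inordK// t1 /adjacent; lia.
  apply: sub; first by rewrite inordK.
  by rewrite (_ : pi _ = ord0)//; apply: val_inj; rewrite /= collapseE inordK.
- have dn2 : d < n.+2 by lia.
  exists (Ordinal dn2); last by rewrite inE t0 /adjacent /=; lia.
  apply: sub; first by rewrite /=; lia.
  by rewrite (_ : pi _ = Ordinal d1n)//; apply: val_inj; rewrite /= collapseE.
Qed.

End Contraction.
Lemma card_lower_boolean (T : finType) (L : {set {set T}}) rk (X : {set T}) r :
  (forall Y : {set T}, Y \subset X -> Y \in L /\ rk Y = #|Y|) ->
  #|lower L rk X r| = 'C(#|X|, r).
Proof.
move=> H; rewrite -cards_draws; apply: eq_card => Y; rewrite [in RHS]inE.
apply/setIdP/andP => [[YL /andP[YX]]|[YX cY]].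
  by have [_ ->] := H Y YX.
by have [YL ->] := H Y YX; split=> //; rewrite YX.
Qed.

Lemma card_init n m : m <= n.+1 -> #|init n m| = m.
Proof.
move=> mn; have inj : injective (widen_ord mn) by move=> i j [] /val_inj.
rewrite -[RHS]card_ord -(card_imset _ inj); apply: eq_card => j.
rewrite inE; apply/idP/imsetP => [jm|[i _ ->]]; last by rewrite /= ltn_ord.
by exists (Ordinal jm) => //; exact: val_inj.
Qed.

(** The invariant of the induction on n. [mrank_down] and [mrank_up] supply the saturated chains
    that later identify [mrank] with the geometric rank; [mrank_le] makes the subtraction in
    [mexcess] exact. *)
Record mgraded d n : Prop := MGraded {
  mrank_lt : forall X Y, X \in msets d n -> Y \in msets d n ->
    X \proper Y -> mrank d X < mrank d Y;
  mrank_le : forall X, X \in msets d n -> mrank d X <= #|X|;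
  mrank_setT : mrank d [set: 'I_n.+1] = d.+1;
  mrank_down : forall X, X \in msets d n -> X != set0 ->
    exists Y, [/\ Y \in msets d n, Y \proper X & mrank d X = (mrank d Y).+1];
  mrank_up : forall X, X \in msets d n -> X != [set: 'I_n.+1] ->
    exists Y, [/\ Y \in msets d n, X \proper Y & mrank d Y = (mrank d X).+1];
  msets_multiplicial :
    multiplicial (msets d n) (@mrank d n) (@mexcess d n) }.

Lemma msets_setT d n : [set: 'I_n.+1] \in msets d n.
Proof. by apply/msetsP => t; rewrite inE. Qed.

Lemma mgraded_simplex d : 1 < d -> mgraded d d.
Proof.
move=> d2.
have all_in (X : {set 'I_d.+1}) : X \in msets d d.
  apply/msetsP => t tX.
  have ne j : j \in X -> j != t :> nat by move=> jX; apply: contraNneq tX => /val_inj <-.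
  have tlt := ltn_ord t.
  suff [i [it iN]] : exists i : 'I_d.+1, ~~ adjacent d d i t /\
      forall j : 'I_d.+1, j != t :> nat -> adjacent d d i j.
    by exists i; [apply/subsetP => j /ne/iN; rewrite inE | rewrite inE].
  (* The facet missing only t is [F_t] for 0 < t < d; the diagonal convention makes it [F_d] for t =
     0 and [F_0] for t = d. *)
  have [t0|t0] := eqVneq (t : nat) 0.
    by exists ord_max; split=> [|j]; [|have := ltn_ord j]; rewrite /adjacent /= ?t0; lia.
  have [td|td] := eqVneq (t : nat) d.
    by exists ord0; split=> [|j]; [|have := ltn_ord j]; rewrite /adjacent /= ?td; lia.
  by exists t; split=> [|j]; [|have := ltn_ord j]; rewrite /adjacent; lia.
have rankE (X : {set 'I_d.+1}) : mrank d X = #|X|.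
  by clear all_in; case: d d2 X => // m _ X /=; rewrite leqnn.
split=> [X Y _ _ XY|X _||X _ X0|X _ XT|X _]; rewrite ?rankE//.
- exact: proper_card.
- by rewrite cardsT card_ord.
- have [t tX] := set0Pn _ X0.
  exists (X :\ t); split=> //; first exact: properD1.
  by rewrite !rankE (cardsD1 t X) tX.
- have [t tX] : exists t, t \notin X.
    apply/existsP; apply: contraNT XT; rewrite negb_exists => /forallP H.
    by apply/eqP/setP => t; rewrite inE; have := H t; rewrite negbK.
  exists (t |: X); split=> //; last by rewrite !rankE cardsU1 tX.
  by rewrite setUC; apply: properUl; rewrite sub1set.
- have cl r : #|lower (msets d d) (@mrank d d) X r| = 'C(#|X|, r).
    by apply: card_lower_boolean.
  split=> [|r|r|]; rewrite ?cl ?bin0//; rewrite /mexcess ?rankE ?subnn ?addn0 //.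
  by rewrite big1// => Y _; rewrite rankE subnn.
Qed.

(** * Induction step for the rank function *)

Section Step.
Variables (d n : nat) (d2 : 2 <= d) (dn : d <= n) (IH : mgraded d n).
Local Notation L := (msets d n).
Local Notation L' := (msets d n.+1).
Local Notation pi := (@collapse n).
Local Notation small := (init n d.-1).
Local Notation small' := (init n.+1 d).
Local Notation dn' := (leqW dn).

Lemma small_msets (X : {set 'I_n.+1}) : X \subset small ->
  X \in L /\ mrank d X = #|X|.
Proof.
move=> Xs; have Xi : X \subset init n d.
  by apply: (subset_trans Xs); apply/subsetP => j; rewrite !inE; lia.
by rewrite msets_init// mrank_init.
Qed.

Lemma small'_msets (X : {set 'I_n.+2}) : X \subset small' ->
  X \in L' /\ mrank d X = #|X|.
Proof. by move=> Xs; rewrite (msets_init d2 dn') // (mrank_init dn'). Qed.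

Lemma setT_big : ~~ ([set: 'I_n.+2] \subset small').
Proof.
by apply/subsetPn; exists ord_max; rewrite inE //= -leqNgt leqW.
Qed.

Lemma collapse_setT : pi @: [set: 'I_n.+2] = [set: 'I_n.+1].
Proof.
apply/setP => t; rewrite inE; apply/imsetP.
have t1 : t.+1 < n.+2 by have := ltn_ord t.
by exists (Ordinal t1) => //; apply: val_inj; rewrite /= collapseE.
Qed.

Lemma step_rank_lt (X Y : {set 'I_n.+2}) : X \in L' -> Y \in L' ->
  X \proper Y -> mrank d X < mrank d Y.
Proof.
move=> XL YL XY; have sXY := proper_sub XY.
have [Ys|nY] := boolP (Y \subset small').
  have Xs := subset_trans sXY Ys.
  by have [_ ->] := small'_msets Xs; have [_ ->] := small'_msets Ys; exact: proper_card.
rewrite (mrank_big dn nY); have YL' := collapse_msets d2 dn YL nY.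
have [Xs|nX] := boolP (X \subset small'); last first.
  rewrite (mrank_big dn nX); apply: (mrank_lt IH) => //; first exact: collapse_msets.
  rewrite properEneq imsetS// andbT; apply: contraTneq XY => E.
  by rewrite properE negb_and negbK (collapse_subset d2 dn YL XL nY nX) ?orbT// E.
have [_ ->] := small'_msets Xs; rewrite card_collapse.
have piXs : pi @: X \subset small by rewrite collapse_small.
have [piXL piXr] := small_msets piXs; rewrite -piXr.
have nY' : ~~ (pi @: Y \subset small) by rewrite collapse_small.
have piXY : pi @: X \proper pi @: Y.
  by rewrite properE imsetS//=; apply: contra nY' => /subset_trans; apply.
(* If X contains 0 and 1, its image has one point fewer, so a single strict inclusion is not enough.
   By [big_shift] Y contains d and d+1, so its image contains d-1 and d, and the image of X with d-1
   added is a member strictly in between. *)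
case E: (ends X); last by rewrite addn0; exact: (mrank_lt IH).
move: E; rewrite /ends => /andP[X0 X1].
have d1n : d.-1 < n.+1 by clear -d2 dn; lia.
have dd2 : d < n.+2 by clear -d2 dn; lia.
pose a : 'I_n.+1 := Ordinal d1n.
have aX : a \notin pi @: X by apply/negP => /(subsetP piXs); rewrite inE /= ltnn.
have aY : a \in pi @: Y.
  have := big_shift d2 dn YL nY (subsetP sXY _ X0) isT.
  move=> /(_ (Ordinal dd2)) H; apply/imsetP; exists (Ordinal dd2).
    by apply: H; rewrite /= addn0.
  by apply: val_inj; rewrite /= collapseE.
have d1lt : d.+1 < n.+2 by clear -dn; lia.
have bY : Ordinal (d1lt : d < n.+1) \in pi @: Y.
  have := big_shift d2 dn YL nY (subsetP sXY _ X1).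
  rewrite inordK// => /(_ (Ordinal d1lt) isT) H; apply/imsetP; exists (Ordinal d1lt).
    by apply: H; rewrite /= addn1.
  by apply: val_inj; rewrite /= collapseE.
have Us : a |: pi @: X \subset init n d.
  rewrite subUset sub1set inE /=; apply/andP; split; first by clear -d2; lia.
  by apply: (subset_trans piXs); apply/subsetP => j; rewrite !inE; clear; lia.
have rU : mrank d (a |: pi @: X) = #|pi @: X|.+1.
  by rewrite (mrank_init dn Us) cardsU1 aX.
rewrite addn1 piXr -rU.
apply: (mrank_lt IH) => //; first exact: msets_init.
apply/properP; split; first by rewrite subUset sub1set aY imsetS.
exists (Ordinal (d1lt : d < n.+1)) => //.
by apply/negP => /(subsetP Us); rewrite inE /= ltnn.
Qed.

Lemma step_rank_le (X : {set 'I_n.+2}) : X \in L' -> mrank d X <= #|X|.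
Proof.
move=> XL; have [Xs|nX] := boolP (X \subset small').
  by have [_ ->] := small'_msets Xs.
rewrite (mrank_big dn nX) card_collapse; apply: leq_trans (leq_addr _ _).
by apply: (mrank_le IH); exact: collapse_msets.
Qed.

Lemma step_rank_setT : mrank d [set: 'I_n.+2] = d.+1.
Proof. by rewrite (mrank_big dn setT_big) collapse_setT (mrank_setT IH). Qed.

Lemma step_rank_down (X : {set 'I_n.+2}) : X \in L' -> X != set0 ->
  exists Y : {set 'I_n.+2}, [/\ Y \in L', Y \proper X & mrank d X = (mrank d Y).+1].
Proof.
move=> XL X0; have [Xs|nX] := boolP (X \subset small').
  have [t tX] := set0Pn _ X0.
  have Ys : X :\ t \subset small' by apply: subset_trans Xs; exact: subD1set.
  exists (X :\ t); have [-> ->] := small'_msets Ys; have [_ ->] := small'_msets Xs.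
  by split=> //; [exact: properD1 | rewrite (cardsD1 t X) tX].
have piXL := collapse_msets d2 dn XL nX.
have piX0 : pi @: X != set0 by rewrite imset_eq0.
have [Y [YL YX rY]] := mrank_down IH piXL piX0.
rewrite (mrank_big dn nX) rY.
have [Ys|nY] := boolP (Y \subset small); last first.
  have [Y' [Y'L nY' Y'E]] := collapse_surj d2 dn YL nY.
  exists Y'; split=> //; last by rewrite (mrank_big dn nY') Y'E.
  rewrite properEneq (collapse_subset d2 dn Y'L XL nY' nX) ?Y'E ?(proper_sub YX)//.
  by rewrite andbT; apply: contraTneq YX => YX; rewrite -Y'E YX properxx.
(* One preimage in X for each point of Y, so that the sizes agree: 1 is dropped when 0 is
   available. *)
pose Y' := [set j in X | (pi j \in Y) && ~~ ((j == inord 1) && (ord0 \in X))].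
have YE : pi @: Y' = Y.
  apply/setP => t; apply/imsetP/idP => [[j]|tY].
    by rewrite !inE => /and3P[_ jY _] ->.
  have /imsetP[j jX jt] := subsetP (proper_sub YX) t tY.
  have [/andP[/eqP j1 X0']|j1] := boolP ((j == inord 1) && (ord0 \in X)); last first.
    by exists j => //; rewrite !inE jX -jt tY j1.
  have e : pi ord0 = t by rewrite jt j1; apply: val_inj; rewrite /= !collapseE inordK.
  by exists ord0 => //; rewrite !inE X0' e tY -val_eqE /= inordK.
have Y's : Y' \subset small' by rewrite -collapse_small ?YE.
have [Y'L Y'r] := small'_msets Y's.
exists Y'; split=> //.
  rewrite properE; apply/andP; split; first by apply/subsetP => j; rewrite inE => /andP[].
  by apply: contra nX => /subset_trans; apply.
rewrite Y'r card_collapse YE; have [_ ->] := small_msets Ys.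
rewrite (_ : ends Y' = false) ?addn0//; apply/negbTE.
by rewrite /ends !inE; case: (ord0 \in X); rewrite ?eqxx ?andbF.
Qed.

Lemma step_rank_up (X : {set 'I_n.+2}) : X \in L' -> X != [set: 'I_n.+2] ->
  exists Y : {set 'I_n.+2}, [/\ Y \in L', X \proper Y & mrank d Y = (mrank d X).+1].
Proof.
move=> XL XT; have [Xs|nX] := boolP (X \subset small').
  have [_ Xr] := small'_msets Xs.
  have [E|ne] := eqVneq X small'.
    exists [set: 'I_n.+2]; split; [exact: msets_setT|by rewrite properEneq XT subsetT|].
    rewrite step_rank_setT Xr E; congr _.+1.
    by rewrite (card_init (leqW (leqW dn))).
  have /properP[_ [t ts tX]] : X \proper small' by rewrite properEneq ne.
  have Us : t |: X \subset small' by rewrite subUset sub1set ts.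
  exists (t |: X); have [-> ->] := small'_msets Us; rewrite Xr; split=> //.
    by rewrite setUC; apply: properUl; rewrite sub1set.
  by rewrite cardsU1 tX.
have piXL := collapse_msets d2 dn XL nX.
have piXT : pi @: X != [set: 'I_n.+1].
  apply: contraNneq XT => E; rewrite -subTset.
  apply: (collapse_subset d2 dn (msets_setT _ _) XL setT_big nX).
  by rewrite E subsetT.
have [Y [YL XY rY]] := mrank_up IH piXL piXT.
have nY : ~~ (Y \subset small).
  have : ~~ (pi @: X \subset small) by rewrite collapse_small.
  by apply: contra; apply: subset_trans; exact: proper_sub.
have [Y' [Y'L nY' Y'E]] := collapse_surj d2 dn YL nY.
exists Y'; split=> //; last by rewrite (mrank_big dn nY') (mrank_big dn nX) Y'E.
rewrite properEneq (collapse_subset d2 dn XL Y'L nX nY') ?Y'E ?(proper_sub XY)//.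
by rewrite andbT; apply: contraTneq XY => ->; rewrite Y'E properxx.
Qed.

End Step.

(** * Members containing both 0 and 1 *)

Section Step.
Variables (d n : nat) (d2 : 2 <= d) (dn : d <= n) (IH : mgraded d n).
Local Notation L := (msets d n).
Local Notation L' := (msets d n.+1).
Local Notation pi := (@collapse n).
Local Notation small := (init n d.-1).
Local Notation small' := (init n.+1 d).
Local Notation dn' := (leqW dn).

(* For 0, 1 in W and W included in F_0, star W is the unique intersection of
   facets other than F_0 whose trace on F_0 is W. *)
Definition star (W : {set 'I_n.+2}) := [set t : 'I_n.+2 |
  [forall i : 'I_n.+2, (1 < i < d) && (i \notin W) ==> (t \in mfacet d i)]].

Lemma starP (W : {set 'I_n.+2}) t :
  reflect (forall i : 'I_n.+2, 1 < i < d -> i \notin W -> t \in mfacet d i)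
          (t \in star W).
Proof.
rewrite inE; apply: (iffP forallP) => [H i id iW|H i].
  by have := H i; rewrite id iW.
by apply/implyP => /andP[id iW]; exact: H.
Qed.

Lemma starS (W W' : {set 'I_n.+2}) : W \subset W' -> star W \subset star W'.
Proof.
move=> sWW; apply/subsetP => t /starP H; apply/starP => i id iW; apply: H => //.
by apply: contra iW => /(subsetP sWW).
Qed.

Lemma star_msets (W : {set 'I_n.+2}) : star W \in L'.
Proof.
apply/msetsP => t; rewrite inE negb_forall => /existsP[i].
rewrite negb_imply => /andP[/andP[id iW] ti]; exists i => //.
by apply/subsetP => s /starP; apply.
Qed.

(** For 1 < i < d the facet [F_i] misses i and no other point of [F_0]. The points 0 and 1 are never
    cut off, hence the hypothesis [ends W]. *)
Lemma star_small (W : {set 'I_n.+2}) : ends W -> W \subset small' ->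
  star W :&: small' = W.
Proof.
move=> /andP[W0 W1] Ws; apply/setP => t; apply/setIP/idP => [[/starP H]|tW].
  rewrite inE => td; apply: contraT => tW.
  have t0 : t != ord0 by apply: contraNneq tW => ->.
  have t1 : t != inord 1 by apply: contraNneq tW => ->.
  have := H t; rewrite tW inE /adjacent; move: t0 t1 td (dn).
  by rewrite -!val_eqE /= inordK//; clear; lia.
split; last exact: (subsetP Ws).
apply/starP => i id iW; rewrite inE.
have it : i != t :> nat by apply: contraNneq iW => /val_inj ->.
have := subsetP Ws t tW; rewrite inE /adjacent; move: it id; clear; lia.
Qed.

Lemma star_big (W : {set 'I_n.+2}) : ~~ (star W \subset small').
Proof.
have dn2 : d < n.+2 by clear -dn; lia.
apply/negP => /subsetP sub.
have /sub : Ordinal dn2 \in star W; last by rewrite [_ \in small']inE /= ltnn.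
apply/starP => i id _; rewrite inE /adjacent /=.
by move: id; clear; lia.
Qed.

(** A facet other than [F_0] through 0 and 1 has index i with 1 < i < d. Hence the facets containing
    X are those [F_i] with i not in X, which are the ones used by [star] on the trace. *)
Lemma star_id (X : {set 'I_n.+2}) : X \in L' -> ends X -> ~~ (X \subset small') ->
  star (X :&: small') = X.
Proof.
move=> XL /andP[X0 X1] nX; have facetX i : X \subset mfacet d i -> 1 < i < d.
  move=> Xi; have i0 := facet_gt0 d2 dn nX Xi.
  have := subsetP Xi _ X0; have := subsetP Xi _ X1; rewrite !inE inordK// /adjacent /=.
  by move: i0 d2 dn; clear; lia.
apply/eqP; rewrite eqEsubset; apply/andP; split; apply/subsetP => t.
  move=> /starP H; apply: contraT => tX; have [i Xi ti] := msetsP _ _ XL t tX.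
  have id := facetX i Xi; case/negP: ti; apply: H => //.
  rewrite inE negb_and; apply/orP; left; apply/negP => /(subsetP Xi).
  by rewrite inE /adjacent; move: id (dn); clear; lia.
move=> tX; apply/starP => i id; rewrite inE [i \in small']inE.
have [_ -> /=] := andP id; rewrite andbT => iX.
have [j Xj ij] := msetsP _ _ XL i iX; have jd := facetX j Xj.
rewrite (_ : i = j); first exact: (subsetP Xj).
apply: val_inj => /=; move: ij; rewrite inE /adjacent; move: id jd (dn); clear; lia.
Qed.

(** The trace is a simplex properly inside X, which gives the lower bound. For the upper bound,
    adding points to the trace one by one gives a strictly increasing chain of stars whose last rank
    is at most d+1. *)
Lemma mrank_ends (X : {set 'I_n.+2}) : X \in L' -> ends X -> ~~ (X \subset small') ->
  mrank d X = #|X :&: small'|.+1.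
Proof.
move=> XL Xe nX; apply/eqP; rewrite eqn_leq; apply/andP; split; last first.
  have [_ <-] := small'_msets d2 dn (subsetIr X small').
  apply: (step_rank_lt d2 dn IH) => //.
    by have [] := small'_msets d2 dn (subsetIr X small').
  by rewrite properEneq subsetIl andbT; apply: contra nX => /eqP/setIidPl.
have [m] := ubnP (d - #|X :&: small'|); elim: m X XL Xe nX => // m IHm X XL Xe nX.
rewrite ltnS => Xm; set W := X :&: small'.
have Wd : #|W| <= d.
  by have := subset_leq_card (subsetIr X small'); rewrite (card_init (leqW dn')).
have [E|ne] := eqVneq #|W| d.
  rewrite E -(step_rank_setT dn IH).
  have [->//|XT] := eqVneq X [set: 'I_n.+2].
  apply/ltnW/(step_rank_lt d2 dn IH) => //; first exact: msets_setT.
  by rewrite properEneq XT subsetT.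
have /properP[_ [t ts tW]] : W \proper small'.
  rewrite properEcard subsetIr (card_init (leqW dn')).
  by rewrite ltn_neqAle ne.
have tX : t \notin X by apply: contra tW => tX; rewrite inE tX.
set W2 := t |: W.
have W2s : W2 \subset small' by rewrite subUset sub1set ts subsetIr.
have W2e : ends W2.
  by move: Xe => /andP[X0 X1]; rewrite /ends !in_setU !in_setI X0 X1 !in_set
     inordK//= d2 (ltnW d2) !orbT.
have W2E := star_small W2e W2s.
have e : ends (star W2).
  have sub : W2 \subset star W2 by rewrite -{1}W2E subsetIl.
  by have /andP[W20 W21] := W2e; rewrite /ends !(subsetP sub).
have := IHm (star W2) (star_msets W2) e (star_big W2).
rewrite W2E cardsU1 tW add1n => H.
have XW2 : X \proper star W2.
  apply/properP; split; first by rewrite -{1}(star_id XL Xe nX) starS// subsetUr.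
  by exists t => //; have /setP/(_ t) := W2E; rewrite !in_setI setU11 => /andP[].
have := step_rank_lt d2 dn IH XL (star_msets W2) XW2.
move/leq_trans => lt; rewrite -ltnS; apply/lt/H.
by move: Xm Wd ne; rewrite -/W; clear; lia.
Qed.

(** Through [star] these members correspond to the subsets of the trace that contain 0 and 1; by
    [mrank_ends] the trace of X has [mrank d X - 1] points, and a member of rank r+3 has a trace of
    r+2 points. *)
Lemma card_lower_ends (X : {set 'I_n.+2}) r :
  X \in L' -> ends X -> ~~ (X \subset small') ->
  #|[set Y in lower L' (@mrank d n.+1) X r.+3 | ends Y && ~~ (Y \subset small')]| =
  'C(mrank d X - 3, r).
Proof.
move=> XL Xe nX; set W := X :&: small'.
pose ee : {set 'I_n.+2} := [set ord0; inord 1].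
have ends_sub (Y : {set 'I_n.+2}) : ends Y = (ee \subset Y).
  by rewrite /ends subUset !sub1set.
have ee_small : ee \subset small'.
  by rewrite subUset !sub1set !in_set inordK//= d2 (ltnW d2).
have card_ee : #|ee| = 2 by rewrite cards2 -val_eqE /= inordK.
have We : ee \subset W by rewrite subsetI ee_small -ends_sub Xe.
pose D := W :\: ee.
have cardD : #|D| = mrank d X - 3.
  by rewrite (mrank_ends XL Xe nX) (cardsDS We) card_ee !subSS.
have backE (V : {set 'I_n.+2}) : V \subset D -> star (V :|: ee) :&: small' = V :|: ee.
  move=> VD; apply: star_small; first by rewrite ends_sub subsetUr.
  rewrite subUset ee_small andbT; apply: (subset_trans VD).
  by apply: subset_trans (subsetIr X small'); exact: subsetDl.
have UeeK (V : {set 'I_n.+2}) : V \subset D -> (V :|: ee) :\: ee = V.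
  rewrite subsetD => /andP[_ Ve].
  by rewrite setDUl setDv setU0; apply/setDidPl.
rewrite -cardD -cards_draws -(card_in_imset (f := fun V => star (V :|: ee))); last first.
  move=> V V'; rewrite !in_set => /andP[VD _] /andP[VD' _] /= E.
  by rewrite -(UeeK _ VD) -(UeeK _ VD') -(backE _ VD) -(backE _ VD') E.
apply: eq_card => Y; apply/setIdP/imsetP.
  move=> [/setIdP[YL /andP[YX /eqP rY]] /andP[Ye nY]].
  have eY : ee \subset Y :&: small' by rewrite subsetI ee_small -ends_sub Ye.
  exists ((Y :&: small') :\: ee).
    rewrite inE setSD ?setSI//=; apply/eqP.
    by have := mrank_ends YL Ye nY; rewrite rY cardsDS// card_ee => -[<-]; rewrite subn2.
  by rewrite -[X in _ :|: X](setIidPr eY) setUC setID star_id.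
move=> [V]; rewrite inE => /andP[VD /eqP cV] ->.
have e : ends (star (V :|: ee)).
  rewrite ends_sub; apply: (@subset_trans _ _ (star (V :|: ee) :&: small')).
    by rewrite backE// subsetUr.
  exact: subsetIl.
rewrite e star_big; split=> //; apply/setIdP; rewrite star_msets; split=> //.
apply/andP; split.
  rewrite -(star_id XL Xe nX); apply: starS; rewrite subUset We andbT.
  by apply: (subset_trans VD); exact: subsetDl.
rewrite mrank_ends ?star_msets ?star_big// backE// cardsU card_ee cV.
move: VD; rewrite subsetD => /andP[_ /disjoint_setI0->].
by rewrite cards0 subn0 addn2.
Qed.

End Step.
Lemma card_lower_split (T : finType) (L : {set {set T}}) rk (X S : {set T}) r :
  (forall Y : {set T}, Y \subset S -> Y \in L /\ rk Y = #|Y|) ->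
  #|lower L rk X r| = 'C(#|X :&: S|, r) +
    \sum_(Y in lower L rk X r | ~~ (Y \subset S)) 1.
Proof.
move=> H; rewrite -sum1_card (bigID (fun Y : {set T} => Y \subset S)) /=; congr (_ + _).
rewrite sum1_card -cards_draws; apply: eq_card => Y; rewrite [RHS]inE subsetI.
apply/andP/andP => [[/setIdP[_ /andP[-> rY]] YS]|[/andP[YX YS] cY]].
  by rewrite YS; have [_ <-] := H Y YS.
have [YL rY] := H Y YS; rewrite YS; split=> //.
by apply/setIdP; rewrite YX rY.
Qed.

(** * Induction step for the counts *)

Section Step.
Variables (d n : nat) (d2 : 2 <= d) (dn : d <= n) (IH : mgraded d n).
Arguments mrank : simpl never.
Local Notation L := (msets d n).
Local Notation L' := (msets d n.+1).
Local Notation pi := (@collapse n).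
Local Notation small := (init n d.-1).
Local Notation small' := (init n.+1 d).

Lemma sum_lower_collapse (X : {set 'I_n.+2}) r (F : {set 'I_n.+1} -> nat) :
  X \in L' -> ~~ (X \subset small') ->
  \sum_(Y in lower L' (@mrank d n.+1) X r | ~~ (Y \subset small')) F (pi @: Y) =
  \sum_(Y in lower L (@mrank d n) (pi @: X) r | ~~ (Y \subset small)) F Y.
Proof.
move=> XL nX.
pose A := [set Y in lower L' (@mrank d n.+1) X r | ~~ (Y \subset small')].
have sumE (T : finType) (B : {set {set T}}) (Q : pred {set T}) (G : {set T} -> nat) :
    \sum_(Y in B | Q Y) G Y = \sum_(Y in [set Z in B | Q Z]) G Y.
  by apply: eq_bigl => Y; rewrite inE.
rewrite !sumE -/A -(big_imset (h := fun Y : {set 'I_n.+2} => pi @: Y)) /=; last first.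
  apply: sub_in2 (collapse_inj d2 dn) => Y /setIdP[/setIdP[YL _] nY].
  by apply/setIdP.
apply: eq_bigl => Y; apply/imsetP/setIdP => [[Z /setIdP[/setIdP[ZL /andP[ZX rZ]] nZ] ->]|].
  rewrite collapse_small//; split=> //; apply/setIdP.
  by rewrite (collapse_msets d2 dn ZL nZ) imsetS//= -(mrank_big dn nZ).
move=> [/setIdP[YL /andP[YX rY]] nY].
have [Z [ZL nZ ZE]] := collapse_surj d2 dn YL nY.
exists Z => //; apply/setIdP; split=> //; apply/setIdP; split=> //.
rewrite (collapse_subset d2 dn ZL XL nZ nX) ?ZE//=.
by rewrite (mrank_big dn nZ) ZE.
Qed.

Lemma step_multiplicial :
  multiplicial L' (@mrank d n.+1) (@mexcess d n.+1).
Proof.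
have excess_small (Y : {set 'I_n.+2}) : Y \subset small' -> mexcess d Y = 0.
  by move=> Ys; rewrite /mexcess; have [_ ->] := small'_msets d2 dn Ys; rewrite subnn.
move=> X XL; have [Xs|nX] := boolP (X \subset small').
  have sub (Y : {set 'I_n.+2}) : Y \subset X -> Y \in L' /\ mrank d Y = #|Y|.
    by move=> YX; apply: (small'_msets d2 dn); exact: subset_trans Xs.
  have [_ rX] := sub X (subxx X).
  rewrite excess_small//; split=> [|r|r|//].
  - by rewrite (card_lower_boolean _ sub) bin0.
  - by rewrite (card_lower_boolean _ sub) rX addn0.
  rewrite mul0n big1// => Y /setIdP[_ /andP[YX _]].
  by apply: excess_small; exact: subset_trans Xs.
have PL := collapse_msets d2 dn XL nX.
have [card0 cardP sumP e_gt0] := msets_multiplicial IH PL.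
have smallE : #|X :&: small'| = #|pi @: X :&: small| + ends X.
  rewrite card_collapse; congr (#|pred_of_set _| + nat_of_bool _); last first.
    by rewrite /ends !in_setI !in_set inordK//= d2 (ltnW d2) !andbT.
  apply/setP => t; apply/imsetP/setIP => [[j /setIP[jX js] ->]|[/imsetP[j jX ->] ts]].
    split; first exact: imset_f.
    by move: js; rewrite !inE collapseE; move: d2; clear; lia.
  exists j => //; rewrite inE jX; move: ts; rewrite !inE collapseE.
  by move: d2; clear; lia.
have excessE (Y : {set 'I_n.+2}) : Y \in L' -> ~~ (Y \subset small') ->
    mexcess d Y = mexcess d (pi @: Y) + ends Y.
  move=> YL nY; rewrite /mexcess (mrank_big dn nY) card_collapse addnBAC//.
  by apply: (mrank_le IH); exact: collapse_msets.
(* Away from the Boolean parts the collapse is a bijection; adding the opposite binomial on each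
   side avoids truncated subtraction. *)
have cardE r : #|lower L' (@mrank d n.+1) X r| + 'C(#|pi @: X :&: small|, r) =
    #|lower L (@mrank d n) (pi @: X) r| + 'C(#|X :&: small'|, r).
  rewrite (card_lower_split _ _ (small_msets d2 dn)).
  rewrite (card_lower_split _ _ (small'_msets d2 dn)).
  rewrite (sum_lower_collapse r (fun=> 1) XL nX); ring.
have sumE r : \sum_(Y in lower L' (@mrank d n.+1) X r.+3) mexcess d Y =
    \sum_(Y in lower L (@mrank d n) (pi @: X) r.+3) mexcess d Y +
    #|[set Y in lower L' (@mrank d n.+1) X r.+3 | ends Y && ~~ (Y \subset small')]|.
  rewrite (bigID (fun Y : {set 'I_n.+2} => Y \subset small')) /= big1 ?add0n; last first.
    by move=> Y /andP[_]; exact: excess_small.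
  rewrite [X in _ = X + _](bigID (fun Y : {set 'I_n.+1} => Y \subset small)) /=.
  rewrite [X in _ = X + _ + _]big1 ?add0n; last first.
    move=> Y /andP[_ Ys]; rewrite /mexcess.
    by have [_ ->] := small_msets d2 dn Ys; rewrite subnn.
  rewrite -(sum_lower_collapse _ (@mexcess d n))// -sum1_card.
  under eq_bigr => Y /andP[/setIdP[YL _] nY] do rewrite (excessE Y YL nY).
  rewrite big_split /=; congr (_ + _).
  have boolE (b : bool) : b = (if b then 1 else 0) :> nat by case: b.
  under eq_bigr do rewrite boolE.
  rewrite -big_mkcondr /=; apply: eq_bigl => Y; rewrite [RHS]inE -andbA.
  by congr (_ && _); exact: andbC.
rewrite excessE// (mrank_big dn nX).
case Xe: (ends X) smallE; last first.
  rewrite addn0 => smallE; rewrite !addn0; split=> [|r|r|//].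
  - by have := cardE 0; rewrite !bin0 card0 => /addIn.
  - by have := cardE r.+1; rewrite smallE -cardP => /addIn.
  - rewrite sumE sumP; apply/eqP; rewrite -[X in _ == X]addn0 eqn_add2l cards_eq0.
    apply/eqP/setP => Y; rewrite [RHS]inE; apply/negbTE/negP => /setIdP[/setIdP[_ /andP[YX _]]].
    move=> /andP[/andP[Y0 Y1] _]; move/negP: Xe; apply.
    by rewrite /ends !(subsetP YX).
move=> smallE; have rX := mrank_ends d2 dn IH XL Xe nX.
have k1 : mrank d (pi @: X) = #|pi @: X :&: small|.+2.
  by rewrite -(mrank_big dn nX) rX smallE addn1.
(* Both 0 and 1 lie in the trace, so excess is created only in rank at least 3. *)
have a2 : 0 < #|pi @: X :&: small|.
  suff : 1 < #|X :&: small'| by rewrite smallE addn1.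
  have /andP[X0 X1] := Xe.
  rewrite (cardsD1 ord0) (cardsD1 (inord 1)) !inE X0 X1 /= inordK// d2 (ltnW d2).
  by rewrite -val_eqE /= inordK.
split=> [|r|r|_].
- by have := cardE 0; rewrite !bin0 card0 => /addIn.
- have := cardE r.+1; rewrite smallE cardP k1 addn1 (binS #|pi @: X :&: small|) mulnDl mul1n.
  by rewrite !subSS subn0; clear; lia.
- rewrite sumE sumP (card_lower_ends d2 dn IH r XL Xe nX) (mrank_big dn nX).
  by rewrite mulnDl mul1n.
- by rewrite k1.
Qed.

End Step.

Theorem mgradedP d n : 1 < d -> d <= n -> mgraded d n.
Proof.
move=> d2; elim: n => [|n IHn] dn; first by move: d2 dn; clear; lia.
move: dn; rewrite leq_eqVlt => /predU1P[E|dn].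
  by have := mgraded_simplex d2; rewrite {2}E.
have IH := IHn dn; split.
- exact: step_rank_lt.
- exact: step_rank_le.
- exact: step_rank_setT.
- exact: step_rank_down.
- exact: step_rank_up.
- exact: step_multiplicial.
Qed.

(** * Faces of a finite vector configuration *)

Local Open Scope ring_scope.

Section ConeFaces.
Variables (R : realFieldType) (m : nat) (T : finType) (v : T -> 'rV[R]_m).
Implicit Types (X Y Z : {set T}) (c : 'cV[R]_m).

Definition lev c (x : 'rV[R]_m) : R := (x *m c) 0 0.

Lemma levDl c c' x : lev (c + c') x = lev c x + lev c' x.
Proof. by rewrite /lev mulmxDr mxE. Qed.
Lemma levZl a c x : lev (a *: c) x = a * lev c x.
Proof. by rewrite /lev -scalemxAr mxE. Qed.
Lemma levNl c x : lev (- c) x = - lev c x.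
Proof. by rewrite /lev mulmxN mxE. Qed.
Lemma levB c x y : lev c (x - y) = lev c x - lev c y.
Proof. by rewrite /lev mulmxBl !mxE. Qed.

(** The linear form of a face: affine constants are absorbed by the height coordinate introduced
    later. The ambient X is a parameter so that faces of faces can be treated. *)
Definition coneface X Z := exists c,
  (forall t, t \in X -> 0 <= lev c (v t)) /\
  Z = [set t in X | lev c (v t) == 0].

Definition cspan Z : {vspace 'rV[R]_m} := <<[seq v t | t in Z]>>%VS.
Definition crank Z : nat := \dim (cspan Z).

Lemma mem_cspan Z t : t \in Z -> v t \in cspan Z.
Proof. by move=> tZ; apply/memv_span/image_f. Qed.

Lemma cspan_sub Z (U : {vspace 'rV[R]_m}) :
  (forall t, t \in Z -> v t \in U) -> (cspan Z <= U)%VS.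
Proof. by move=> H; apply/span_subvP => _ /imageP[t tZ ->]; exact: H. Qed.

Lemma cspanS Z Y : Z \subset Y -> (cspan Z <= cspan Y)%VS.
Proof. by move/subsetP=> ZY; apply: cspan_sub => t /ZY; exact: mem_cspan. Qed.

Lemma crankS Z Y : Z \subset Y -> (crank Z <= crank Y)%N.
Proof. by move=> ZY; apply/dimvS/cspanS. Qed.

Lemma lev_cspan0 c Z : (forall t, t \in Z -> lev c (v t) = 0) ->
  forall x, x \in cspan Z -> lev c x = 0.
Proof.
move=> H x; have : (cspan Z <= lker (linfun (mulmxr c)))%VS.
  apply: cspan_sub => t tZ; rewrite memv_ker lfunE /=.
  by apply/eqP/matrixP => i j; rewrite !ord1 [RHS]mxE; exact: H.
move/subvP => sub /sub; rewrite memv_ker lfunE /= => /eqP xc.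
by rewrite /lev xc mxE.
Qed.

(** The identity minus the projection onto U vanishes exactly on U; a nonzero coordinate of its
    value at x gives the functional. *)
Lemma separation (U : {vspace 'rV[R]_m}) x : x \notin U ->
  exists2 c, lev c x != 0 & forall u, u \in U -> lev c u = 0.
Proof.
move=> xU; pose f : 'End('rV[R]_m) := (\1 - projv U)%VF.
have [j fxj] : exists j, (f x) 0 j != 0.
  apply/existsP; apply: contraNT xU; rewrite negb_exists => /forallP H.
  have : f x = 0.
    by apply/rowP => j; rewrite mxE; have := H j; rewrite negbK => /eqP.
  by rewrite /f !lfun_simp /= => /eqP; rewrite subr_eq0 => /eqP ->; exact: memv_proj.
have levE y : lev (col j (lin1_mx f)) y = (f y) 0 j.
  rewrite /lev -mul_rV_lin1 [LHS]mxE [RHS]mxE; apply: eq_bigr => k _.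
  by rewrite [col _ _ _ _]mxE.
exists (col j (lin1_mx f)) => [|u uU]; rewrite levE//.
by rewrite /f !lfun_simp projv_id// subrr mxE.
Qed.

Lemma coneface_refl X : coneface X X.
Proof.
have lev0 t : lev 0 (v t) = 0 by rewrite /lev mulmx0 mxE.
exists 0; split=> [t _|]; first by rewrite lev0.
by apply/setP => t; rewrite inE lev0 eqxx andbT.
Qed.

Lemma coneface_sub X Z : coneface X Z -> Z \subset X.
Proof. by case=> c [_ ->]; apply/subsetP => t; rewrite inE => /andP[]. Qed.

Lemma conefaceI X Y Z : coneface X Y -> coneface X Z -> coneface X (Y :&: Z).
Proof.
move=> [c [c0 ->]] [c' [c'0 ->]]; exists (c + c'); split=> [t tX|].
  by rewrite levDl addr_ge0 ?c0 ?c'0.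
apply/setP => t; rewrite !inE; case tX: (t \in X) => //=.
by rewrite levDl paddr_eq0 ?c0 ?c'0.
Qed.

Lemma coneface_subface X Y Z : coneface X Y -> coneface X Z -> Z \subset Y ->
  coneface Y Z.
Proof.
move=> /coneface_sub/subsetP YX [c [c0 ZE]] ZY; exists c.
split=> [t /YX/c0//|]; apply/setP => t; rewrite inE.
case tY: (t \in Y); first by rewrite ZE inE YX.
by apply: contraFF tY => /(subsetP ZY).
Qed.

(* If c cuts Y out of X and g cuts Z out of Y, then M c + g cuts Z out of X for
   M large. *)
Lemma coneface_trans X Y Z : coneface X Y -> coneface Y Z -> coneface X Z.
Proof.
move=> XY YZ; have YX := subsetP (coneface_sub XY); have ZY := subsetP (coneface_sub YZ).
case: XY YZ => c [c0 YE] [g [g0 ZE]].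
pose M := 1 + \sum_(t in X :\: Y) `|lev g (v t)| / lev c (v t).
have cN t : t \in X :\: Y -> 0 < lev c (v t).
  rewrite inE {1}YE inE => /andP[tY tX]; rewrite tX /= in tY.
  by rewrite lt0r tY c0.
have big t : t \in X :\: Y -> 0 < M * lev c (v t) + lev g (v t).
  move=> tN; have ct := cN t tN.
  have : 1 + `|lev g (v t)| / lev c (v t) <= M.
    rewrite /M lerD2l (bigD1 t)//= lerDl sumr_ge0// => s /andP[sN _].
    by rewrite divr_ge0// ltW// cN.
  rewrite -(ler_pM2r ct) mulrDl mul1r divfK ?gt_eqF// => le.
  rewrite -ltrBlDr sub0r; apply: lt_le_trans le.
  by rewrite ltr_pwDl// -normrN ler_norm.
have onY t : t \in Y -> lev c (v t) = 0 by rewrite YE inE => /andP[_ /eqP].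
exists (M *: c + g); split=> [t tX|].
  rewrite levDl levZl; have [tY|tY] := boolP (t \in Y); last first.
    by apply/ltW/big; rewrite inE tY.
  by rewrite onY// mulr0 add0r g0.
apply/setP => t; rewrite inE levDl levZl.
have [tX|tX] /= := boolP (t \in X); last first.
  by apply: contraNF tX => /ZY/YX.
have [tY|tY] := boolP (t \in Y).
  by rewrite onY// mulr0 add0r {1}ZE inE tY.
by rewrite gt_eqF ?big ?inE ?tY//; apply: contraNF tY => /ZY.
Qed.

Lemma crank_lt_lev c Y Z t : (forall s, s \in Z -> lev c (v s) = 0) ->
  Z \subset Y -> t \in Y -> lev c (v t) != 0 -> (crank Z < crank Y)%N.
Proof.
move=> cZ ZY tY; rewrite ltn_neqAle crankS// andbT.
apply: contraNN => /eqP dimE; have /eqP spanE : (cspan Z == cspan Y)%VS.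
  by rewrite eqEdim cspanS//= -[\dim _]/(crank Y) -dimE.
by apply/eqP/(lev_cspan0 cZ); rewrite spanE mem_cspan.
Qed.

Lemma crank_lt X Y Z : coneface X Z -> Y \subset X -> Z \proper Y ->
  (crank Z < crank Y)%N.
Proof.
move=> [c [c0 ZE]] /subsetP YX /properP[ZY [t tY tZ]].
apply: (@crank_lt_lev c _ _ t) => //.
  by move=> s; rewrite ZE inE => /andP[_ /eqP].
by move: tZ; rewrite ZE inE YX.
Qed.

(* Rotates the supporting hyperplane c around its contact face towards g until
   it meets a new point. *)
Lemma coneface_tilt X c g b : (forall t, t \in X -> 0 <= lev c (v t)) ->
  (forall t, t \in X -> lev c (v t) = 0 -> lev g (v t) = 0) ->
  b \in X -> 0 < lev g (v b) ->
  exists k Y, [/\ 0 < k, coneface X Y,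
    Y = [set t in X | lev c (v t) == k * lev g (v t)] &
    exists2 t, t \in Y & lev c (v t) != 0].
Proof.
move=> c0 cg bX gb; pose P t := (t \in X) && (0 < lev g (v t)).
have Pb : P b by rewrite /P bX gb.
(* The least ratio is the largest k for which [c - k g] stays nonnegative on X; a minimiser is the
   new contact point. *)
case: (arg_minP (fun t => lev c (v t) / lev g (v t)) Pb) => a /andP[aX ga] amin.
have ca : 0 < lev c (v a).
  by rewrite lt0r c0// andbT; apply: contraTneq ga => /(cg _ aX) ->; rewrite ltxx.
set k := _ / _ in amin.
have k0 : 0 < k by rewrite divr_gt0.
exists k, [set t in X | lev c (v t) == k * lev g (v t)]; split=> //.
  exists (c - k *: g); split=> [t tX|]; last first.
    by apply/setP => t; rewrite !inE levDl levNl levZl subr_eq0.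
  rewrite levDl levNl levZl subr_ge0; have [gt|gt] := ltP 0 (lev g (v t)).
    by rewrite -ler_pdivlMr// amin// /P tX.
  by apply: le_trans (c0 _ tX); rewrite pmulr_rle0.
by exists a; [rewrite inE aX /k divfK ?eqxx// gt_eqF | rewrite gt_eqF].
Qed.

(* Rotating in both directions of a pencil gives two larger faces with
   intersection Z. *)
Lemma coneface_meet X Z : coneface X Z -> ((crank Z).+2 <= crank X)%N ->
  exists Z1 Z2, [/\ coneface X Z1, coneface X Z2, Z = Z1 :&: Z2,
    Z \proper Z1 & Z \proper Z2].
Proof.
move=> XZ rZ; have /subsetP ZX := coneface_sub XZ; case: (XZ) => c [c0 ZE].
have cZ t : t \in Z -> lev c (v t) = 0 by rewrite ZE inE => /andP[_ /eqP].
have [a aX aZ] : exists2 a, a \in X & a \notin Z.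
  apply/exists_inP; apply: contraLR rZ; rewrite negb_exists_in => /forall_inP H.
  by rewrite -ltnNge ltnS leqW//; apply: crankS; apply/subsetP => t /H; rewrite negbK.
(* The rank gap of at least 2 leaves a point b outside the span of Z and a, so some g vanishes on Z
   and at a but is positive at b. *)
have [b bX bZ] : exists2 b, b \in X & v b \notin (cspan Z + <[v a]>)%VS.
  apply/exists_inP; apply: contraLR rZ; rewrite negb_exists_in => /forall_inP H.
  rewrite -ltnNge ltnS; apply: leq_trans (_ : \dim (cspan Z + <[v a]>) <= _)%N.
    by apply: dimvS; apply: cspan_sub => t /H; rewrite negbK.
  apply: leq_trans (dimv_add_leqif _ _) _; rewrite -[(crank Z).+1]addn1 leq_add2l dim_vline.
  exact: leq_b1.
have [g0 g0b g0U] := separation bZ.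
have [g gb [ga gZ]] : exists2 g, 0 < lev g (v b) &
    lev g (v a) = 0 /\ forall t, t \in Z -> lev g (v t) = 0.
  have Ua : lev g0 (v a) = 0.
    by apply: g0U; apply: (subvP (addvSr _ _)); exact: memv_line.
  have UZ t : t \in Z -> lev g0 (v t) = 0.
    by move=> tZ; apply: g0U; apply: (subvP (addvSl _ _)); exact: mem_cspan.
  have [pos|neg|E] := ltgtP (lev g0 (v b)) 0; last by rewrite E eqxx in g0b.
  - exists (- g0); rewrite ?levNl ?oppr_gt0//; split; first by rewrite Ua oppr0.
    by move=> t tZ; rewrite levNl UZ ?oppr0.
  - by exists g0.
have cpos t : t \in X -> t \notin Z -> 0 < lev c (v t).
  by move=> tX tZ; rewrite lt0r c0// andbT; apply: contraNN tZ => t0; rewrite ZE inE tX.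
have bNZ : b \notin Z by apply: contraTN gb => /gZ->; rewrite ltxx.
have ca := cpos a aX aZ; have cb := cpos b bX bNZ.
(* With this s, [g - s c] is half of g at b and negative at a. It vanishes on Z and takes both signs
   on X, so c can be tilted both ways. *)
pose s := lev g (v b) / (2 * lev c (v b)).
have s0 : 0 < s by rewrite divr_gt0// mulr_gt0.
pose g' := g - s *: c.
have g'E t : lev g' (v t) = lev g (v t) - s * lev c (v t).
  by rewrite /g' levDl levNl levZl.
have g'Z t : t \in X -> lev c (v t) = 0 -> lev g' (v t) = 0.
  by move=> tX ct; rewrite g'E gZ ?ct ?mulr0 ?subr0// ZE inE tX ct eqxx.
have g'b : 0 < lev g' (v b).
  rewrite g'E subr_gt0 /s invfM mulrA divfK ?gt_eqF//.
  by rewrite gtr_pMr// invf_lt1// ltr1n.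
have g'a : 0 < lev (- g') (v a).
  by rewrite levNl g'E ga sub0r opprK mulr_gt0.
have [k1 [Z1 [k10 F1 E1 [t1 t1Z1 ct1]]]] := coneface_tilt c0 g'Z bX g'b.
have g''Z t : t \in X -> lev c (v t) = 0 -> lev (- g') (v t) = 0.
  by move=> tX ct; rewrite levNl g'Z// oppr0.
have [k2 [Z2 [k20 F2 E2 [t2 t2Z2 ct2]]]] := coneface_tilt c0 g''Z aX g'a.
have sub1 : Z \subset Z1.
  by apply/subsetP => t tZ; rewrite E1 inE ZX//= cZ// g'Z ?cZ ?ZX// mulr0.
have sub2 : Z \subset Z2.
  by apply/subsetP => t tZ; rewrite E2 inE ZX//= cZ// g''Z ?cZ ?ZX// mulr0.
exists Z1, Z2; split=> //.
- apply/eqP; rewrite eqEsubset subsetI sub1 sub2 /=; apply/subsetP => t.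
  (* On both faces [c = k1 g' = - k2 g'] with positive k1 and k2, so c cannot be positive there. *)
  rewrite inE E1 E2 !inE => /andP[/andP[tX /eqP e1] /andP[_ /eqP]].
  rewrite levNl mulrN => e2; rewrite ZE inE tX /=.
  have := c0 t tX; rewrite le0r => /orP[//|pos].
  have g1 : 0 < lev g' (v t) by rewrite -(pmulr_rgt0 _ k10) -e1.
  by move: pos; rewrite e2 oppr_gt0 pmulr_rlt0// ltNge (ltW g1).
- rewrite properE sub1; apply/subsetPn; exists t1 => //.
  by apply: contra ct1 => /cZ ->.
- rewrite properE sub2; apply/subsetPn; exists t2 => //.
  by apply: contra ct2 => /cZ ->.
Qed.

(** A face of corank at least 2 is the intersection of two larger ones, and one of these still
    misses t; repetition ends at a facet. *)
Lemma coneface_facet X Z t : coneface X Z -> t \in X -> t \notin Z ->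
  exists G, [/\ coneface X G, (crank G).+1 = crank X, Z \subset G & t \notin G].
Proof.
have [k] := ubnP (crank X - crank Z); elim: k Z => // k IH Z.
rewrite ltnS => rk XZ tX tZ.
have ZX : Z \proper X.
  by apply/properP; split; [exact: coneface_sub | exists t].
have := crank_lt XZ (subxx X) ZX; rewrite leq_eqVlt => /predU1P[E|lt].
  by exists Z.
have [Z1 [Z2 [F1 F2 E P1 P2]]] := coneface_meet XZ lt.
have step Y : coneface X Y -> Z \proper Y -> t \notin Y -> 
    exists G, [/\ coneface X G, (crank G).+1 = crank X, Z \subset G & t \notin G].
  move=> FY PY tY; have [|G [FG rG sG tG]] := IH Y _ FY tX tY.
    apply: leq_trans rk; have := crank_lt XZ (coneface_sub FY) PY.
    move: lt; clear; lia.
  by exists G; split=> //; exact: subset_trans (proper_sub PY) sG.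
have : t \notin Z1 :&: Z2 by rewrite -E.
by rewrite inE negb_and => /orP[]; [exact: step F1 P1 | exact: step F2 P2].
Qed.

(* The functionals vanishing on Z are spanned by those of the two faces found by
   rotation, so any third face would be cut out by a nonnegative combination of
   these. *)
Lemma coneface_diamond X Z : coneface X Z -> crank X = (crank Z).+2 ->
  exists Z1 Z2, [/\ Z1 != Z2, coneface X Z1 /\ coneface X Z2,
    Z \proper Z1 /\ Z \proper Z2, Z1 \proper X /\ Z2 \proper X
    & forall Y, coneface X Y -> Z \proper Y -> Y \proper X -> Y = Z1 \/ Y = Z2].
Proof.
move=> XZ rX; have [Z1 [Z2 [F1 F2 E P1 P2]]] := coneface_meet XZ (eq_leq (esym rX)).
have N1 : Z1 != X.
  by apply: contraTneq P2 => E1; rewrite E E1 (setIidPr (coneface_sub F2)) properxx.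
have N2 : Z2 != X.
  by apply: contraTneq P1 => E2; rewrite E E2 (setIidPl (coneface_sub F1)) properxx.
exists Z1, Z2; split=> //.
- by apply: contraTneq P1 => E12; rewrite E E12 setIid properxx.
- by rewrite !properEneq N1 N2 !coneface_sub.
move=> Y FY PY YX.
have [_ [u1 u1Z1 u1Z]] := properP P1; have [_ [u2 u2Z2 u2Z]] := properP P2.
have u1Z2 : u1 \notin Z2 by apply: contra u1Z => u1Z2; rewrite E inE u1Z1.
have u2Z1 : u2 \notin Z1 by apply: contra u2Z => u2Z1; rewrite E inE u2Z1.
have /subsetP Z1X := coneface_sub F1; have /subsetP Z2X := coneface_sub F2.
case: (F1) => c1 [c10 E1]; case: (F2) => c2 [c20 E2]; case: (FY) => c [c0 YE].
have c1u1 : lev c1 (v u1) = 0 by move: u1Z1; rewrite E1 inE => /andP[_ /eqP].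
have c2u2 : lev c2 (v u2) = 0 by move: u2Z2; rewrite E2 inE => /andP[_ /eqP].
have c1u2 : lev c1 (v u2) != 0 by move: u2Z1; rewrite E1 inE Z2X.
have c2u1 : lev c2 (v u1) != 0 by move: u1Z2; rewrite E2 inE Z1X.
have c1Z t : t \in Z -> lev c1 (v t) = 0.
  by move/(subsetP (proper_sub P1)); rewrite E1 inE => /andP[_ /eqP].
have c2Z t : t \in Z -> lev c2 (v t) = 0.
  by move/(subsetP (proper_sub P2)); rewrite E2 inE => /andP[_ /eqP].
have cZ t : t \in Z -> lev c (v t) = 0.
  by move/(subsetP (proper_sub PY)); rewrite YE inE => /andP[_ /eqP].
(* The coefficients of c in terms of c1 and c2 are read off at u2, where c2 vanishes, and at u1,
   where c1 vanishes. *)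
pose al := lev c (v u2) / lev c1 (v u2); pose be := lev c (v u1) / lev c2 (v u1).
have al0 : 0 <= al by rewrite divr_ge0 ?c0 ?c10 ?Z2X.
have be0 : 0 <= be by rewrite divr_ge0 ?c0 ?c20 ?Z1X.
have ZX : Z \subset X := coneface_sub XZ.
have r1 : (crank Z < crank (u1 |: Z))%N.
  by apply: (crank_lt_lev c2Z (subsetUr _ _) (setU11 _ _)).
have r2 : (crank (u1 |: Z) < crank (u2 |: (u1 |: Z)))%N.
  apply: (@crank_lt_lev c1 _ _ u2); rewrite ?subsetUr ?setU11// => s.
  by rewrite !inE => /predU1P[->|/c1Z].
have UX : u2 |: (u1 |: Z) \subset X by rewrite !subUset !sub1set ZX (Z1X _ u1Z1) (Z2X _ u2Z2).
(* u1 and u2 each raise the rank of Z, which together exhausts the gap of 2; an identity between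
   functionals therefore need only be checked on Z, u1 and u2. *)
have /eqP spanE : cspan (u2 |: (u1 |: Z)) == cspan X.
  rewrite eqEdim cspanS//= -[\dim _]/(crank X) rX.
  exact: leq_ltn_trans r1 r2.
have cE t : t \in X -> lev c (v t) = al * lev c1 (v t) + be * lev c2 (v t).
  move=> tX; apply/eqP; rewrite -subr_eq0 opprD addrA.
  have : lev (c - al *: c1 - be *: c2) (v t) = 0.
    apply: (@lev_cspan0 _ (u2 |: (u1 |: Z))); last by rewrite spanE mem_cspan.
    move=> s; rewrite !levDl !levNl !levZl !inE => /or3P[/eqP->|/eqP->|sZ].
    - by rewrite c2u2 mulr0 subr0 divfK ?subrr.
    - by rewrite c1u1 mulr0 subr0 divfK ?subrr.
    - by rewrite cZ// c1Z// c2Z// !mulr0 !subr0.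
  by rewrite !levDl !levNl !levZl => ->.
have [al_eq|al_ne] := eqVneq al 0.
  have be_ne : be != 0.
    apply: contraTneq YX => be_eq; rewrite properE negb_and negbK; apply/orP; right.
    by apply/subsetP => t tX; rewrite YE inE tX cE// al_eq be_eq !mul0r addr0 eqxx.
  right; apply/setP => t; rewrite YE E2 !inE; case tX: (t \in X) => //=.
  by rewrite cE// al_eq mul0r add0r mulf_eq0 (negbTE be_ne).
have [be_eq|be_ne] := eqVneq be 0.
  left; apply/setP => t; rewrite YE E1 !inE; case tX: (t \in X) => //=.
  by rewrite cE// be_eq mul0r addr0 mulf_eq0 (negbTE al_ne).
case/negP: (proper_neq PY); apply/eqP; rewrite E YE E1 E2; apply/setP => t.
rewrite !inE; case tX: (t \in X) => //=.
rewrite cE// paddr_eq0 ?(mulr_ge0 al0 (c10 t tX)) ?(mulr_ge0 be0 (c20 t tX))//.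
by rewrite (mulf_eq0 al) (mulf_eq0 be) (negbTE al_ne) (negbTE be_ne).
Qed.

(** Since h is 1 on all points, subtracting the minimum of g times h makes g nonnegative on Z with
    zero set where the minimum is attained. *)
Lemma coneface_min X Z (h g : 'cV[R]_m) : (forall t, lev h (v t) = 1) ->
  coneface X Z -> Z != set0 -> exists2 a, a \in Z &
    coneface X [set t in Z | lev g (v t) == lev g (v a)] /\
    forall t, t \in Z -> lev g (v a) <= lev g (v t).
Proof.
move=> h1 XZ /set0Pn[z zZ].
case: (arg_minP (fun t => lev g (v t)) zZ) => a aZ amin.
exists a => //; split=> //; apply: (coneface_trans XZ).
exists (g - lev g (v a) *: h).
have gE t : lev (g - lev g (v a) *: h) (v t) = lev g (v t) - lev g (v a).
  by rewrite levDl levNl levZl h1 mulr1.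
split=> [t tZ|]; first by rewrite gE subr_ge0 amin.
by apply/setP => t; rewrite !inE gE subr_eq0.
Qed.

(** A functional that distinguishes two vectors of Z cuts out a smaller face. Different indices may
    carry the same vector, so the process stops at a constant family rather than at a singleton. *)
Lemma coneface_vertex X Z (h : 'cV[R]_m) : (forall t, lev h (v t) = 1) ->
  coneface X Z -> Z != set0 ->
  exists Y, [/\ coneface X Y, Y \subset Z, Y != set0 &
    forall s t, s \in Y -> t \in Y -> v s = v t].
Proof.
move=> h1; have [k] := ubnP #|Z|; elim: k Z => // k IH Z; rewrite ltnS => Zk XZ Z0.
have [[s t] /=|all_eq] := pickP [pred q : T * T | [&& q.1 \in Z, q.2 \in Z & v q.1 != v q.2]].
  case/and3P=> sZ tZ st.
  have [g gst _] : exists2 g, lev g (v s - v t) != 0 &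
      forall u, u \in (0%VS : {vspace 'rV[R]_m}) -> lev g u = 0.
    by apply: separation; rewrite memv0 subr_eq0.
  have [a aZ [FK amin]] := coneface_min g h1 XZ Z0.
  set K := [set _ in _ | _] in FK.
  have KZ : K \proper Z.
    rewrite properE; apply/andP; split; first by apply/subsetP => u; rewrite inE => /andP[].
    apply: contraNN gst => /subsetP ZK; rewrite levB.
    have := ZK s sZ; have := ZK t tZ; rewrite !inE.
    by move=> /andP[_ /eqP->] /andP[_ /eqP->]; rewrite subrr.
  have [||Y [FY YK Y0 Yv]] := IH K _ FK.
  - exact: leq_trans (proper_card KZ) Zk.
  - by apply/set0Pn; exists a; rewrite inE aZ eqxx.
  by exists Y; split=> //; exact: subset_trans YK (proper_sub KZ).
exists Z; split=> // s t sZ tZ; have := all_eq (s, t).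
by rewrite /= sZ tZ /= => /negbFE/eqP.
Qed.

(** The functional c defining Z' is positive somewhere on Z, so the face of Z where c is largest
    avoids Z' and contains a vertex. *)
Lemma coneface_vertex_notin X Z Z' (h : 'cV[R]_m) : (forall t, lev h (v t) = 1) ->
  coneface X Z -> coneface X Z' -> ~~ (Z \subset Z') ->
  exists Y, [/\ coneface X Y, Y \subset Z :\: Z', Y != set0 &
    forall s t, s \in Y -> t \in Y -> v s = v t].
Proof.
move=> h1 XZ [c [c0 ZE]] /subsetPn[z zZ zZ'].
have Z0 : Z != set0 by apply/set0Pn; exists z.
have [a aZ [FK amin]] := coneface_min (- c) h1 XZ Z0.
set K := [set _ in _ | _] in FK.
have [|Y [FY YK Y0 Yv]] := coneface_vertex h1 FK.
  by apply/set0Pn; exists a; rewrite inE aZ eqxx.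
exists Y; split=> //; apply: (subset_trans YK); apply/subsetP => t.
rewrite !inE !levNl eqr_opp => /andP[tZ /eqP tE]; rewrite tZ andbT ZE inE negb_and.
apply/orP; right; rewrite tE; have zX := subsetP (coneface_sub XZ) z zZ.
have cz : 0 < lev c (v z).
  by rewrite lt0r c0// andbT; move: zZ'; rewrite ZE inE zX.
by have := amin z zZ; rewrite !levNl lerN2 => /(lt_le_trans cz)/gt_eqF->.
Qed.
End ConeFaces.

(** * Polytopes and their faces *)

Section Polytopes.
Variables (R : realType) (N : nat).
Local Notation E := 'rV[R]_N.

(* Putting points at height 1 turns affine functionals into linear ones and the
   dimension k of a nonempty set into the rank k + 1. *)
Definition homog (x : E) : 'rV[R]_(N + 1) := row_mx x 1.
Definition height : 'cV[R]_(N + 1) := col_mx 0 1.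

Lemma lev_homog (c : 'cV[R]_N) (b : 'M[R]_1) x :
  lev (col_mx c b) (homog x) = (x *m c) 0 0 + b 0 0.
Proof. by rewrite /lev mul_row_col mul1mx mxE. Qed.

Lemma lev_height x : lev height (homog x) = 1.
Proof. by rewrite lev_homog mulmx0 !mxE add0r eqxx. Qed.

Lemma homog_sum (I : finType) (w : I -> R) (q : I -> E) : \sum_i w i = 1 ->
  homog (\sum_i w i *: q i) = \sum_i w i *: homog (q i).
Proof.
move=> w1; rewrite -[RHS]hsubmxK; congr row_mx.
  rewrite linear_sum; apply: eq_bigr => i _.
  by rewrite linearZ /= row_mxKl.
rewrite linear_sum (eq_bigr (fun i => w i *: (1 : 'M[R]_1))) => [|i _].
  by rewrite -scaler_suml w1 scale1r.
by rewrite linearZ /= row_mxKr.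
Qed.

Lemma lev_sum (I : finType) (w : I -> R) (q : I -> E) c : \sum_i w i = 1 ->
  lev c (homog (\sum_i w i *: q i)) = \sum_i w i * lev c (homog (q i)).
Proof.
move=> w1; rewrite homog_sum// /lev mulmx_suml summxE; apply: eq_bigr => i _.
by rewrite -scalemxAl mxE.
Qed.

Section Hull.
Variables (T : finType) (p : T -> E).
Let v t := homog (p t).
Implicit Types (X Y Z : {set T}).

(** Weights are indexed by [T] itself, so that passing to a face is a condition on the support
    alone. *)
Definition chull Z : set E := fun x => exists w : T -> R,
  [/\ forall t, 0 <= w t, forall t, t \notin Z -> w t = 0, \sum_t w t = 1
    & x = \sum_t w t *: p t].

Lemma chull_pt Z t : t \in Z -> chull Z (p t).
Proof.
move=> tZ; exists (fun s => (s == t)%:R); split=> [s|s sZ||].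
- exact: ler0n.
- by rewrite (_ : s == t = false)//; apply: contraNF sZ => /eqP ->.
- by rewrite (bigD1 t)//= eqxx big1 ?addr0// => s /negbTE->.
- by rewrite (bigD1 t)//= eqxx scale1r big1 ?addr0// => s /negbTE->; rewrite scale0r.
Qed.

Lemma chullS Y Z : Y \subset Z -> (chull Y `<=` chull Z)%classic.
Proof.
move=> /subsetP YZ x [w [w0 wY w1 ->]]; exists w; split=> // t tZ.
by apply: wY; apply: contra tZ => /YZ.
Qed.

Lemma chull0 : chull set0 = classical_sets.set0.
Proof.
apply/seteqP; split=> // x [w [_ w0 w1 _]].
by move: w1; rewrite big1 => [/esym/eqP|t _]; rewrite ?oner_eq0// w0// inE.
Qed.

Lemma conv_range : conv (range p) = chull [set: T].
Proof.
apply/seteqP; split=> x; last first.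
  case=> w [w0 _ w1 xE]; exists #|T|, (fun i => p (enum_val i)), (fun i => w (enum_val i)).
  split=> [i|i||]; [by exists (enum_val i)|exact: w0| |].
    by rewrite -(big_enum_val w) -w1; apply: eq_bigl => t; rewrite inE.
  rewrite -(big_enum_val (fun t => w t *: p t)) xE.
  by apply: eq_bigl => t; rewrite inE.
case=> m [q [w [qp w0 w1 xE]]].
have /choice[f fE] i : exists t, q i = p t by have [t _ <-] := qp i; exists t.
exists (fun t => \sum_(i | f i == t) w i); split=> [t|t||].
- by apply: sumr_ge0.
- by rewrite inE.
- by rewrite -w1 (partition_big f xpredT).
rewrite xE (partition_big f xpredT)//=; apply: eq_bigr => t _.
by rewrite scaler_suml; apply: eq_bigr => i /eqP <-; rewrite fE.
Qed.

Lemma chull_convex (A : set E) Z : (A `<=` chull Z)%classic -> (conv A `<=` chull Z)%classic.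
Proof.
move=> AZ x [m [q [u [qA u0 u1 xE]]]].
have /choice[W WE] i : exists w : T -> R, [/\ forall t, 0 <= w t,
    forall t, t \notin Z -> w t = 0, \sum_t w t = 1
    & q i = \sum_t w t *: p t] by exact/AZ/qA.
exists (fun t => \sum_i u i * W i t); split=> [t|t tZ||].
- by apply: sumr_ge0 => i _; have [W0 _ _ _] := WE i; rewrite mulr_ge0.
- by rewrite big1// => i _; have [_ -> //] := WE i; rewrite mulr0.
- rewrite exchange_big /= -u1; apply: eq_bigr => i _.
  by have [_ _ Wi1 _] := WE i; rewrite -mulr_sumr Wi1 mulr1.
- rewrite xE; under [RHS]eq_bigr do rewrite scaler_suml.
  rewrite exchange_big /=; apply: eq_bigr => i _; have [_ _ _ ->] := WE i.
  by rewrite scaler_sumr; apply: eq_bigr => t _; rewrite scalerA.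
Qed.

(** A sum of nonnegative terms vanishes only termwise, so a convex combination on the supporting
    hyperplane has its support in Z. *)
Lemma coneface_chull_lev c X Z x : (forall t, t \in X -> 0 <= lev c (v t)) ->
  Z = [set t in X | lev c (v t) == 0] -> chull X x ->
  0 <= lev c (homog x) /\ (lev c (homog x) = 0 <-> chull Z x).
Proof.
move=> c0 ZE [w [w0 wX w1 xE]].
have term0 t : 0 <= w t * lev c (v t).
  by have [tX|/wX->] := boolP (t \in X); rewrite ?mul0r// mulr_ge0 ?c0.
have levE : lev c (homog x) = \sum_t w t * lev c (v t) by rewrite xE lev_sum.
split; first by rewrite levE sumr_ge0.
split=> [/eqP|[w' [w'0 w'Z w'1 ->]]].
  rewrite levE psumr_eq0// => /allP H; exists w; split=> // t tZ.
  have [tX|/wX->//] := boolP (t \in X).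
  move: (H t (mem_index_enum t)); rewrite /= mulf_eq0 => /orP[/eqP//|ct].
  by move: tZ; rewrite ZE inE tX ct.
rewrite lev_sum// big1// => t _; have [|/w'Z->] := boolP (t \in Z); last by rewrite mul0r.
by rewrite ZE inE => /andP[_ /eqP]; rewrite /v => ->; rewrite mulr0.
Qed.

(** The supporting hyperplane [x c = b] corresponds to the linear functional [(-c, b)], whose value
    at [homog x] is [b - x c]. *)
Lemma face_chull F : face (chull [set: T]) F <->
  exists2 Z, coneface v [set: T] Z & F = chull Z.
Proof.
split=> [[c [b [cP ->]]]|[Z [c [c0 ZE]] ->]].
  pose c' : 'cV[R]_(N + 1) := col_mx (- c) b%:M.
  have c'E x : lev c' (homog x) = b - (x *m c) 0 0.
    by rewrite lev_homog mulmxN !mxE eqxx mulr1n addrC.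
  have c'0 t : t \in [set: T] -> 0 <= lev c' (v t).
    by move=> tT; rewrite c'E subr_ge0 cP//; exact: chull_pt.
  exists [set t in [set: T] | lev c' (v t) == 0]; first by exists c'.
  apply/seteqP; split=> x.
    move=> [Px xb]; have [_ [+ _]] := coneface_chull_lev c'0 erefl Px.
    by apply; rewrite c'E xb subrr.
  move=> Zx; have Px : chull [set: T] x by apply: chullS Zx; exact: subsetT.
  split=> //; have [_ [_ /(_ Zx)]] := coneface_chull_lev c'0 erefl Px.
  by rewrite c'E => /subr0_eq.
exists (- usubmx c), ((dsubmx c) 0 0).
have cE x : lev c (homog x) = (dsubmx c) 0 0 - (x *m - usubmx c) 0 0.
  by rewrite -{1}[c]vsubmxK lev_homog mulmxN !mxE opprK addrC.
split=> [x Px|].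
  by rewrite -subr_ge0 -cE; have [] := coneface_chull_lev c0 ZE Px.
apply/seteqP; split=> x.
  move=> Zx; have Px : chull [set: T] x by apply: chullS Zx; exact: subsetT.
  split=> //; have [_ [_ /(_ Zx)]] := coneface_chull_lev c0 ZE Px.
  by rewrite cE => /subr0_eq ->.
move=> [Px xb]; have [_ [+ _]] := coneface_chull_lev c0 ZE Px.
by apply; rewrite cE xb subrr.
Qed.

Lemma chull_ptE Z t : coneface v [set: T] Z -> chull Z (p t) <-> t \in Z.
Proof.
move=> [c [c0 ZE]]; split; last exact: chull_pt.
have Px : chull [set: T] (p t) by exact: chull_pt.
have [_ [_ H]] := coneface_chull_lev c0 ZE Px.
by move/H => ct; rewrite ZE !inE /v ct eqxx.
Qed.

Lemma chull_subset Y Z : coneface v [set: T] Z ->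
  (chull Y `<=` chull Z)%classic <-> Y \subset Z.
Proof.
move=> FZ; split; last exact: chullS.
by move=> sub; apply/subsetP => t /chull_pt/sub/(chull_ptE _ FZ).
Qed.

Lemma chull_inj Y Z : coneface v [set: T] Y -> coneface v [set: T] Z ->
  chull Y = chull Z -> Y = Z.
Proof.
move=> FY FZ YZ; apply/eqP; rewrite eqEsubset.
by apply/andP; split; apply/chull_subset => //; rewrite YZ.
Qed.

(** All generators have height 1, so the coefficients expressing a vector of height 1 automatically
    sum to 1. *)
Lemma aff_chull Z : aff (chull Z) = (fun x => homog x \in cspan v Z).
Proof.
apply/seteqP; split=> x.
  move=> [m [q [w [qZ w1 ->]]]]; rewrite homog_sum//.
  apply: memv_suml => i _; apply: memvZ.
  have [u [_ uZ u1 ->]] := qZ i; rewrite homog_sum//.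
  apply: memv_suml => t _; have [tZ|/uZ->] := boolP (t \in Z).
    by apply: memvZ; exact: (mem_cspan v tZ).
  by rewrite scale0r mem0v.
rewrite /cspan -[X in <<X>>%VS]/(val (in_tuple _)) => /coord_span.
set k := coord _ => xE.
pose w i := k i (homog x).
have {}xE : homog x = \sum_(i < _) w i *: v (enum_val (cast_ord (size_image _ _) i)).
  rewrite {1}xE; apply: eq_bigr => i _; congr (_ *: _).
  exact: (nth_image 0 (fun t => v t) (cast_ord (size_image _ _) i)).
have w1 : \sum_i w i = 1.
  have := lev_height x; rewrite xE /lev mulmx_suml summxE => <-.
  apply: eq_bigr => i _; rewrite -scalemxAl mxE.
  have := lev_height (p (enum_val (cast_ord (size_image v Z) i))).
  by rewrite /lev => ->; rewrite mulr1.
exists _, (fun i => p (enum_val (cast_ord (size_image v Z) i))), w; split=> //.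
  by move=> i; apply: chull_pt; exact: enum_valP.
have := xE; rewrite -homog_sum// => /(congr1 lsubmx).
by rewrite !row_mxKl.
Qed.

End Hull.
End Polytopes.

Section PolytopeFlags.
Variables (R : realType) (N : nat).
Local Notation E := 'rV[R]_N.

Lemma has_dim_unique (A : set E) k k' : has_dim A k -> has_dim A k' -> k = k'.
Proof.
have sub (U U' : {vspace E}) (x x' : E) :
    aff A = [set x + u | u in [set` U]]%classic ->
    aff A = [set x' + u | u in [set` U']]%classic -> (U <= U')%VS.
  move=> AU AU'; apply/subvP => u uU.
  have /= [u1 u1U' e1] : [set x' + w | w in [set` U']]%classic (x + u).
    by rewrite -AU' AU; exists u.
  have /= [u0 u0U' e0] : [set x' + w | w in [set` U']]%classic x.
    by rewrite -AU' AU; exists 0; rewrite /= ?mem0v ?addr0.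
  have -> : u = u1 - u0 by apply: (addrI x); rewrite -e1 -e0 -addrA [u0 + _]addrC subrK.
  by rewrite rpredB.
move=> [U [x [<- AU]]] [U' [x' [<- AU']]].
by congr dimv; apply: subv_anti; rewrite (sub _ _ _ _ AU AU') (sub _ _ _ _ AU' AU).
Qed.

Variables (T : finType) (p : T -> E).
Let v t := homog (p t).
Implicit Types (X Y Z : {set T}).

(** The span of Z is the direct sum of the direction space of the affine hull, placed at height 0,
    and the line through one point at height 1. For empty Z both sides are false. *)
Lemma has_dim_chull Z k : has_dim (chull p Z) k <-> crank v Z = k.+1.
Proof.
have [->|/set0Pn[t0 t0Z]] := eqVneq Z set0.
  rewrite chull0; split=> [[U [x [_ AU]]]|].
    have : aff classical_sets.set0 x by rewrite AU; exists 0; rewrite /= ?mem0v ?addr0.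
    move=> [m [q [w [q0 w1 _]]]]; move: w1; rewrite big1; last by move=> i; case: (q0 i).
    by move/esym/eqP; rewrite oner_eq0.
  have -> : crank v set0 = 0%N.
    apply/eqP; rewrite /crank dimv_eq0 -subv0; apply: cspan_sub => t.
    by rewrite inE.
  by [].
pose io : 'Hom(E, 'rV[R]_(N + 1)) := linfun (mulmxr (row_mx 1%:M 0)).
have ioE u : io u = row_mx u 0.
  by rewrite lfunE /= mul_mx_row mulmx1 mulmx0.
pose D := (io @^-1: cspan v Z)%VS.
have affD : aff (chull p Z) = [set p t0 + u | u in [set` D]]%classic.
  rewrite aff_chull; apply/seteqP; split=> x.
    move=> xZ; exists (x - p t0); last by rewrite addrC subrK.
    rewrite /= -memv_preim ioE (_ : row_mx _ _ = homog x - v t0).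
      by rewrite rpredB//; exact: mem_cspan.
    by rewrite /v /homog opp_row_mx add_row_mx subrr.
  move=> [u /=]; rewrite -memv_preim ioE => uD <-.
  rewrite (_ : homog _ = v t0 + row_mx u 0); first by rewrite rpredD// mem_cspan.
  by rewrite /v /homog add_row_mx addr0.
have io_inj : lker io == 0%VS.
  by apply/lker0P => u u'; rewrite !ioE => /eq_row_mx[].
have dimD : (\dim D).+1 = crank v Z.
  rewrite -(limg_dim_eq (f := io)) ?(eqP io_inj) ?capv0//.
  have lev_io x : x \in (io @: D)%VS -> lev (height R N) x = 0.
    by case/memv_imgP => u _ ->; rewrite ioE /lev mul_row_col mulmx0 mul0mx addr0 mxE.
  have spanE : cspan v Z = (io @: D + <[v t0]>)%VS.
    apply: subv_anti; rewrite subv_add -memvE mem_cspan// andbT.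
    apply/andP; split.
      apply: cspan_sub => t tZ; rewrite -[v t](subrK (v t0)).
      apply: memv_add; last exact: memv_line.
      have dE : v t - v t0 = io (p t - p t0).
        by rewrite ioE /v /homog opp_row_mx add_row_mx subrr.
      by rewrite dE memv_img// -memv_preim -dE rpredB ?mem_cspan.
    by apply/subvP => _ /memv_imgP[u uD ->]; rewrite memv_preim.
  have cap0 : ((io @: D) :&: <[v t0]> = 0)%VS.
    apply/eqP; rewrite -subv0; apply/subvP => x; rewrite memv_cap memv0.
    move=> /andP[/lev_io x0 /vlineP[a xE]]; move: x0.
    by rewrite xE /lev -scalemxAl mxE -/(lev _ _) lev_height mulr1 => ->; rewrite scale0r.
  have v0 : v t0 != 0.
    apply/eqP => v0; have := lev_height (p t0); rewrite -/(v t0) v0 /lev mul0mx mxE.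
    by move/esym/eqP; rewrite oner_eq0.
  rewrite /crank spanE; have := dimv_sum_cap (io @: D) <[v t0]>.
  by rewrite cap0 dimv0 addn0 dim_vline v0 => ->; rewrite [RHS]addn1.
split=> [hd|rZ].
  have hD : has_dim (chull p Z) (\dim D) by exists D, (p t0).
  by rewrite -dimD (has_dim_unique hd hD).
by exists D, (p t0); split=> //; move: rZ; rewrite -dimD => -[].
Qed.

Definition polyfaces : {set {set T}} := [set Z | `[< coneface v [set: T] Z >]].

Lemma polyfacesP Z : reflect (coneface v [set: T] Z) (Z \in polyfaces).
Proof. by rewrite inE; exact: asboolP. Qed.
End PolytopeFlags.

(** * Flags as chains of index sets *)

Section Chains.
Variables (T : finType) (L : {set {set T}}) (rk : {set T} -> nat).

(* Chains are listed from the top member downwards. *)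
Fixpoint chains (X : {set T}) s : seq (seq {set T}) :=
  if s is r :: s' then [seq Y :: c | Y <- enum (lower L rk X r), c <- chains Y s']
  else [:: [::]].

Lemma size_chains X s : size (chains X s) = nchains L rk X s.
Proof.
elim: s X => [|r s IHs] X //=; rewrite size_allpairs_dep sumnE big_map big_enum /=.
by apply: eq_bigr => Y _; rewrite IHs.
Qed.

Lemma uniq_chains X s : uniq (chains X s).
Proof.
elim: s X => [|r s IHs] X //=; apply: allpairs_uniq_dep; rewrite ?enum_uniq//.
by move=> [Y c] [Y' c'] _ _ /= [-> ->].
Qed.

Lemma mem_chains X s c : (c \in chains X s) =
  [&& path (fun A B : {set T} => B \subset A) X c, all [in L] c & map rk c == s].
Proof.
elim: s X c => [|r s IHs] X c /=.
  by rewrite inE; case: c => [|Y c] //=; rewrite !andbF.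
apply/allpairsPdep/and3P => [[Y [c' [+ + ->]]]|].
  rewrite mem_enum IHs => /setIdP[YL /andP[YX rY]] /and3P[pc cL rc] /=.
  by rewrite YX YL pc cL (eqP rY) (eqP rc).
move: c => [[_ _ /eqP//]|Y c [/andP[YX pc] /andP[YL cL] /eqP[rY rc]]].
exists Y, c; split=> //; first by rewrite mem_enum; apply/setIdP; rewrite YX rY eqxx.
by rewrite IHs; apply/and3P; split=> //; exact/eqP.
Qed.
End Chains.

Section PolytopeFlags.
Variables (R : realType) (N : nat) (T : finType) (p : T -> 'rV[R]_N).
Let v t := homog (p t).
Local Notation phi := (chull p).
Local Notation faces := (polyfaces p).

Lemma crank_eq0 (Z : {set T}) : (crank v Z == 0%N) = (Z == set0).
Proof.
apply/idP/eqP => [|->]; last first.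
  by rewrite /crank dimv_eq0 -subv0; apply: cspan_sub => t; rewrite inE.
rewrite /crank dimv_eq0 => /eqP Z0; apply/eqP; apply: contraT => /set0Pn[t tZ].
have := mem_cspan v tZ; rewrite Z0 memv0 => /eqP vt.
have := lev_height (p t); rewrite -/(v t) vt /lev mul0mx mxE.
by move/esym/eqP; rewrite oner_eq0.
Qed.

Lemma chull_lt (Y Z : {set T}) : Y \in faces -> Z \in faces ->
  (phi Y < phi Z)%O = (Y \proper Z).
Proof.
move=> /polyfacesP FY /polyfacesP FZ; rewrite lt_neqAle properEneq; congr (~~ _ && _).
  by apply/eqP/eqP => [|-> //]; exact: chull_inj.
by apply/idP/idP; rewrite subsetEset => /chull_subset; apply.
Qed.

Lemma chull_lt0 (Z : {set T}) : (classical_sets.set0 < phi Z)%O = (Z != set0).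
Proof.
apply/idP/set0Pn => [|[t tZ]].
  rewrite lt_neqAle => /andP[+ _]; have [->|] := eqVneq Z set0.
    by rewrite chull0 eqxx.
  by move=> /set0Pn.
rewrite lt_neqAle; apply/andP; split; last by rewrite subsetEset.
apply/eqP => Z0; have := chull_pt p tZ.
by rewrite -Z0.
Qed.

Lemma path_chull (c : seq {set T}) : all [in faces] c ->
  path <%O classical_sets.set0 (rcons (rev (map phi c)) (phi [set: T])) =
  path (fun A B : {set T} => B \proper A) [set: T] c && (last [set: T] c != set0).
Proof.
move=> cL; rewrite -[path _ _ _]/(sorted <%O (_ :: _)).
rewrite -rev_cons -rev_rcons rev_sorted /= rcons_path last_map chull_lt0.
congr (_ && _).
have : [set: T] \in faces by apply/polyfacesP; exact: coneface_refl.
elim: c [set: T] cL => //= Y c IHc X /andP[YL cL] XL.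
by rewrite IHc// chull_lt.
Qed.

Lemma crank_lt_faces (Y Z : {set T}) : Y \in faces -> Y \proper Z -> (crank v Y < crank v Z)%N.
Proof. by move=> /polyfacesP FY; apply: (crank_lt FY); exact: subsetT. Qed.

Lemma path_proper_crank (X : {set T}) c : all [in faces] c ->
  path (fun A B : {set T} => B \proper A) X c =
  path (fun A B : {set T} => B \subset A) X c &&
  path (fun a b => b < a)%N (crank v X) (map (crank v) c).
Proof.
elim: c X => //= Y c IHc X /andP[YL cL]; rewrite IHc// properE.
have [YX|] //= := boolP (Y \subset X); rewrite andbCA; congr (_ && (_ && _)).
apply/idP/idP => [nXY|]; last by apply: contraTN => /(crankS v); rewrite -leqNgt.
by apply: crank_lt_faces => //; rewrite properE YX.
Qed.

Lemma flags_chull d (S : {set 'I_d}) (s : seq nat) : crank v [set: T] = d.+1 ->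
  sorted ltn s -> s =i [seq nat_of_ord i | i in S] ->
  flags (phi [set: T]) S =
  [set` [fset rev (map phi c) | c in
     chains faces (crank v) [set: T] (rev [seq k.+1 | k <- s])]%fset]%classic.
Proof.
move=> rT s_sorted sS.
have s_lt k : k \in s -> (k < d)%N.
  by rewrite sS => /imageP[i _ ->]; exact: ltn_ord.
have SE : [set nat_of_ord i | i in [set` S]]%classic = [set` s]%classic.
  apply/seteqP; split=> k /=; rewrite sS.
    by move=> [i iS <-]; apply/imageP; exists i.
  by move=> /imageP[i iS ->]; exists i.
have desc : path (fun a b => b < a)%N d.+1 (rev [seq k.+1 | k <- s]).
  rewrite -[path _ _ _]/(sorted _ (_ :: _)) -rev_rcons rev_sorted -map_rcons sorted_map.
  rewrite (eq_sorted (e' := ltn)); last by move=> a b.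
  exact: sorted_ltn_rcons.
apply/seteqP; split=> Fs.
  move=> [Fs_path Fs_face]; rewrite SE => dimE.
  have [c cL FsE] : exists2 c, all [in faces] c & Fs = rev (map phi c).
    elim: Fs Fs_face {Fs_path dimE} => [|F Fs IHFs] Fs_face; first by exists [::].
    have [|c cL ->] := IHFs; first by move=> G GF; apply: Fs_face; rewrite inE GF orbT.
    have /face_chull[Z FZ ->] := Fs_face F (mem_head _ _).
    exists (rcons c Z); last by rewrite map_rcons rev_rcons.
    by rewrite all_rcons cL andbT; exact/polyfacesP.
  subst Fs; move: (Fs_path); rewrite path_chull// path_proper_crank//.
  move=> /andP[/andP[c_path c_rank] c_last].
  apply/imfsetP; exists c => //=; rewrite mem_chains c_path cL /=; apply/eqP.
  have c_pos Y : Y \in c -> Y != set0.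
    move=> Yc; rewrite -chull_lt0.
    have /allP := order_path_min lt_trans Fs_path; apply.
    by rewrite mem_rcons inE mem_rev map_f ?orbT.
  (* A flag prescribes only the set of its dimensions; two strictly decreasing lists with the same
     members are equal, which recovers the list of ranks. *)
  apply: (@irr_sorted_eq _ (fun a b => b < a)%N).
  - by move=> b a e /= ba eb; exact: ltn_trans eb ba.
  - by move=> a /=; rewrite ltnn.
  - exact: path_sorted c_rank.
  - exact: path_sorted desc.
  move=> a; rewrite mem_rev; apply/mapP/mapP => [[Y Yc aE]|[k ks ->]].
    have : crank v Y != 0%N by rewrite crank_eq0 c_pos.
    case rY : (crank v Y) => [|k]// _; exists k; last by rewrite aE rY.
    have : [set` s]%classic k; last by [].
    rewrite -dimE /=; exists (phi Y); first by rewrite mem_rev map_f.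
    exact/has_dim_chull.
  have : [set` s]%classic k by [].
  rewrite -dimE => -[F /=]; rewrite mem_rev => /mapP[Y Yc ->] /has_dim_chull rY.
  by exists Y.
move=> /imfsetP[c /=]; rewrite mem_chains => /and3P[c_path cL /eqP rc] ->.
split.
- rewrite path_chull// path_proper_crank// c_path rT rc desc /=.
  rewrite -crank_eq0 -(last_map (crank v)) rc rT.
  have := mem_last d.+1 (rev [seq k.+1 | k <- s]).
  by rewrite inE mem_rev => /predU1P[->//|/mapP[k _ ->]].
- move=> F; rewrite mem_rev => /mapP[Z Zc ->]; apply/face_chull; exists Z => //.
  by apply/polyfacesP; exact: (allP cL).
rewrite SE; apply/seteqP; split=> k /=.
  move=> [F]; rewrite mem_rev => /mapP[Y Yc ->] /has_dim_chull rY.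
  have : k.+1 \in map (crank v) c by rewrite -rY map_f.
  by rewrite rc mem_rev mem_map//; exact: succn_inj.
move=> ks; have : k.+1 \in map (crank v) c.
  by rewrite rc mem_rev mem_map//; exact: succn_inj.
move=> /mapP[Y Yc rY]; exists (phi Y); first by rewrite mem_rev map_f.
exact/has_dim_chull.
Qed.

Lemma flag_vector_chull d (S : {set 'I_d}) (s : seq nat) : crank v [set: T] = d.+1 ->
  sorted ltn s -> s =i [seq nat_of_ord i | i in S] ->
  flag_vector (phi [set: T]) S =
  nchains faces (crank v) [set: T] (rev [seq k.+1 | k <- s]).
Proof.
move=> rT s_sorted sS; rewrite /flag_vector (flags_chull rT s_sorted sS) set_fsetK.
rewrite card_in_imfset /=; last first.
  move=> c c'; rewrite !mem_chains => /and3P[_ cL _] /and3P[_ c'L _] /(can_inj revK).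
  elim: c c' cL c'L => [|Y c IHc] [|Y' c'] //= /andP[YL cL] /andP[Y'L c'L] [YE cE].
  by rewrite (IHc c')//; congr (_ :: _); apply: (chull_inj _ _ YE); exact/polyfacesP.
by rewrite undup_id ?uniq_chains// size_chains.
Qed.
End PolytopeFlags.

(** * Pyramids *)

Section MultiplicialPolytopes.
Variable R : realType.

Lemma conv_subset N (A B : set 'rV[R]_N) : (A `<=` B)%classic -> (conv A `<=` conv B)%classic.
Proof.
by move=> AB x [m [q [w [qA w0 w1 xE]]]]; exists m, q, w; split=> // i; exact/AB/qA.
Qed.

Lemma polytope_chull N (P : set 'rV[R]_N) : polytope P ->
  exists (T : finType) (p : T -> 'rV[R]_N), P = chull p [set: T].
Proof.
move=> [A finA ->]; exists (fset_set A : finType), val.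
rewrite -conv_range; congr conv; apply/seteqP; split=> [x Ax|_ [x _ <-]].
  have xA : x \in fset_set A by rewrite in_fset_set//; exact: mem_set.
  by exists [` xA]%fset.
by have := valP x; rewrite in_fset_set// => /set_mem.
Qed.

(** Here k is the rank of the whole polytope, its dimension plus one, and m its excess. The points
    may repeat and need not be vertices. *)
Definition multiplicial_polytope N (P : set 'rV[R]_N) (k m : nat) : Prop :=
  exists (T : finType) (p : T -> 'rV[R]_N) (e : {set T} -> nat),
    [/\ P = chull p [set: T], crank (fun t => homog (p t)) [set: T] = k,
        multiplicial (polyfaces p) (crank (fun t => homog (p t))) e &
        e [set: T] = m].

Lemma flag_vector_multiplicial N (P : set 'rV[R]_N) d m (S : {set 'I_d}) s :
  multiplicial_polytope P d.+1 m ->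
  sorted ltn s -> s =i [seq nat_of_ord i | i in S] ->
  flag_vector P S = (simplex_flags d.+1 (rev [seq k.+1 | k <- s]) +
    m * excess_flags d.+1 (rev [seq k.+1 | k <- s]))%N.
Proof.
move=> [T [p [e [-> rT mult eT]]]] s_sorted sS.
rewrite (flag_vector_chull rT s_sorted sS) (nchains_multiplicial mult).
- by rewrite rT eT.
- by apply/polyfacesP; exact: coneface_refl.
- by rewrite all_rev all_map; apply/allP.
Qed.

Section Pyramid.
Variables (N : nat) (T : finType) (p : T -> 'rV[R]_N) (a : 'rV[R]_N).
Let q (t : option T) := if t is Some t then p t else a.
Let v t := homog (p t).
Let u t := homog (q t).
Hypothesis aP : ~ aff (chull p [set: T]) a.

Lemma apex_notin : homog a \notin cspan v [set: T].
Proof. by apply/negP => aV; apply: aP; rewrite aff_chull. Qed.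

Lemma pyr_baseE (Z : {set option T}) t : (t \in pyr_base Z) = (Some t \in Z).
Proof. by rewrite inE. Qed.

Lemma conv_pyramid :
  conv (chull p [set: T] `|` [set a])%classic = chull q [set: option T].
Proof.
apply/seteqP; split.
  apply: chull_convex => x [|/= ->]; last by rewrite -[a]/(q None); exact: chull_pt.
  rewrite -!conv_range; apply: conv_subset => _ [t _ <-].
  by exists (Some t).
rewrite -(conv_range q); apply: conv_subset => _ [[t|] _ <-]; last by right.
by left; exact: chull_pt.
Qed.

Lemma polyfaces_pyramid : polyfaces q = pyr_sets (polyfaces p).
Proof.
apply/setP => Z; rewrite [RHS]inE; apply/polyfacesP/polyfacesP.
  move=> [c [c0 ZE]]; exists c; split=> [t _|]; first by have := c0 (Some t) (in_setT _).
  by apply/setP => t; rewrite pyr_baseE ZE !inE.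
move=> [c [c0 ZE]]; have [g ga gT] := separation apex_notin.
pose b : R := (None \notin Z)%:R.
(* g vanishes on the base but not at the apex, so a multiple of it sets the value at the apex to 0
   or 1 and leaves the base unchanged. *)
pose c' := c + ((b - lev c (homog a)) / lev g (homog a)) *: g.
have c't t : lev c' (u (Some t)) = lev c (v t).
  rewrite levDl levZl -[u (Some t)]/(v t) (gT (v t)) ?mulr0 ?addr0//.
  exact: (mem_cspan v (in_setT t)).
have c'a : lev c' (u None) = b.
  by rewrite levDl levZl -[u None]/(homog a) divfK// addrC subrK.
exists c'; split=> [[t|] _|]; first by rewrite c't c0.
  by rewrite c'a ler0n.
apply/setP => -[t|]; rewrite !inE.
  by rewrite c't -pyr_baseE ZE !inE.
by rewrite c'a /b; case: (None \in Z); rewrite ?eqxx ?oner_eq0.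
Qed.

Lemma crank_pyramid (Z : {set option T}) : crank u Z = pyr_rank (crank v) Z.
Proof.
have baseE : crank v (pyr_base Z) = crank u (Z :\ None).
  congr dimv; apply: subv_anti; apply/andP; split; apply: cspan_sub.
    move=> t; rewrite pyr_baseE => tZ; rewrite -[v t]/(u (Some t)).
    by apply: mem_cspan; rewrite !inE.
  move=> [t|]; rewrite !inE // => tZ; rewrite -[u _]/(v t).
  by apply: mem_cspan; rewrite pyr_baseE.
rewrite /pyr_rank baseE; have [aZ|aZ] := boolP (None \in Z); last first.
  rewrite addn0; congr (crank u _); apply/setP => t; rewrite in_setD1.
  by case: eqP => //= ->; exact/negbTE.
apply/eqP; rewrite [(_ + true)%N]addn1 eqn_leq; apply/andP; split.
  have sub : (cspan u Z <= cspan u (Z :\ None) + <[u None]>)%VS.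
    apply: cspan_sub => t tZ; have [->|tN] := eqVneq t None.
      by apply: (subvP (addvSr _ _)); exact: memv_line.
    by apply: (subvP (addvSl _ _)); apply: mem_cspan; rewrite !inE tN.
  apply: leq_trans (dimvS sub) _; apply: leq_trans (dimv_add_leqif _ _) _.
  by rewrite -[(crank _ _).+1]addn1 leq_add2l dim_vline leq_b1.
have [g ga gT] := separation apex_notin.
apply: (@crank_lt_lev _ _ _ _ g _ _ None) => //; last exact: subD1set.
by move=> [t|]; rewrite !inE // => tZ; apply: gT; exact: (mem_cspan v (in_setT t)).
Qed.

End Pyramid.

Lemma multiplicial_polytope_pyramid N (P Q : set 'rV[R]_N) k m :
  multiplicial_polytope P k m -> pyramid P Q -> multiplicial_polytope Q k.+1 m.
Proof.
move=> [T [p [e [-> rT mult eT]]]] [a aP ->].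
exists (option T : finType), (fun t => if t is Some t then p t else a), (e \o @pyr_base T).
have baseT : pyr_base [set: option T] = [set: T] by apply/setP => t; rewrite !inE.
split.
- exact: conv_pyramid.
- by rewrite (crank_pyramid aP) /pyr_rank baseT rT inE addn1.
- rewrite (polyfaces_pyramid aP); have /funext -> := crank_pyramid aP.
  exact: multiplicial_pyramid.
- by rewrite /= baseT.
Qed.

End MultiplicialPolytopes.

(** * Polygons *)

Section Polygons.
Variables (R : realType) (N : nat).

Lemma card_finset_eqII (U : finType) (V : {set U}) n :
  ([set` V] #= `I_n)%card -> #|V| = n.
Proof.
move=> VI; rewrite cardE -(undup_id (enum_uniq V)) -card_fseq.
apply/card_eq_fsetP; rewrite (_ : [set` _]%classic = [set` V]%classic)//.
by apply/seteqP; split=> x /=; rewrite in_fset /= mem_enum.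
Qed.

Section Faces.
Variables (T : finType) (p : T -> 'rV[R]_N).
Let v t := homog (p t).
Local Notation L := (polyfaces p).
Local Notation rk := (crank v).

Lemma setT_faces : [set: T] \in L.
Proof. by apply/polyfacesP; exact: coneface_refl. Qed.

Lemma set0_faces : set0 \in L.
Proof.
apply/polyfacesP; exists (height R N); split=> [t _|]; first by rewrite lev_height.
by apply/setP => t; rewrite !inE lev_height oner_eq0.
Qed.

Lemma faces_eq (Y Z : {set T}) : Y \in L -> Y \subset Z -> (rk Z <= rk Y)%N -> Y = Z.
Proof.
move=> YL YZ rZY; apply/eqP; apply: contraLR rZY => ne.
by rewrite -ltnNge; apply: (crank_lt_faces YL); rewrite properEneq ne.
Qed.

Lemma lower0 (X : {set T}) : lower L rk X 0 = [set set0].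
Proof.
apply/setP => Y; rewrite [RHS]inE; apply/setIdP/eqP => [[_ /andP[_]]|->].
  by rewrite crank_eq0 => /eqP.
by rewrite set0_faces sub0set crank_eq0 eqxx.
Qed.

Lemma lower_rank (X : {set T}) : X \in L -> lower L rk X (rk X) = [set X].
Proof.
move=> XL; apply/setP => Y; rewrite [RHS]inE.
apply/setIdP/eqP => [[YL /andP[YX /eqP rY]]|->]; last by rewrite XL subxx eqxx.
by apply: faces_eq; rewrite ?rY.
Qed.

Lemma lower_gt (X : {set T}) r : (rk X < r)%N -> lower L rk X r = set0.
Proof.
move=> rX; apply/setP => Y; rewrite [RHS]inE; apply/negbTE/negP => /setIdP[_ /andP[YX /eqP rY]].
by have := crankS v YX; rewrite rY leqNgt rX.
Qed.

Lemma card_between (X Z : {set T}) : X \in L -> Z \in L -> Z \subset X ->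
  rk X = (rk Z).+2 ->
  #|[set Y in L | [&& Z \subset Y, Y \subset X & rk Y == (rk Z).+1]]| = 2%N.
Proof.
move=> XL ZL ZX rX; have /polyfacesP FX := XL; have /polyfacesP FZ := ZL.
have [Z1 [Z2 [ne [F1 F2] [P1 P2] [Q1 Q2] uniq]]] :=
  coneface_diamond (coneface_subface FX FZ ZX) rX.
have inL Y : coneface v X Y -> Y \in L.
  by move=> FY; apply/polyfacesP; exact: coneface_trans FY.
have rE Y : Y \in L -> Z \proper Y -> Y \proper X -> rk Y == (rk Z).+1.
  move=> YL ZY YX; rewrite eqn_leq (crank_lt_faces ZL ZY) andbT -ltnS -rX.
  exact: crank_lt_faces.
have -> : 2%N = #|[set Z1; Z2]| by rewrite cards2 ne.
apply: eq_card => Y; rewrite [in RHS]inE.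
apply/setIdP/orP => [[YL /and3P[ZY YX rY]]|]; last first.
  by case=> /set1P ->; rewrite ?inL ?(proper_sub P1) ?(proper_sub P2)
     ?(proper_sub Q1) ?(proper_sub Q2) ?rE ?inL.
have /polyfacesP FY := YL.
have [|||->|->] := uniq Y; rewrite ?inE ?eqxx; [| | |by left|by right].
- exact: (coneface_subface FX FY).
- rewrite properEneq ZY andbT; apply: contraTneq rY => <-.
  by rewrite ltn_eqF.
- rewrite properEneq YX andbT; apply: contraTneq rY => ->.
  by rewrite rX eqSS gtn_eqF.
Qed.

(** A vertex is represented by all indices that carry it. *)
Lemma vertices_faces (x : 'rV[R]_N) : vertices (chull p [set: T]) x ->
  exists2 Z, Z \in L & [/\ rk Z = 1%N, chull p Z = [set x]%classic &
     forall t, (t \in Z) = (p t == x)].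
Proof.
move=> /face_chull[Z FZ xE].
have ZE t : (t \in Z) = (p t == x).
  by apply/idP/eqP => [/(chull_ptE t FZ)|tx]; [rewrite -xE | apply/(chull_ptE t FZ); rewrite -xE].
exists Z; first exact/polyfacesP.
split=> //; apply/has_dim_chull; rewrite -xE.
exists 0%VS, x; rewrite dimv0; split=> //; apply/seteqP; split=> y.
  move=> [m [q [w [qx w1 ->]]]]; exists 0; first by rewrite /= mem0v.
  rewrite addr0 (eq_bigr (fun i => w i *: x)) => [|i _]; last by rewrite (qx i).
  by rewrite -scaler_suml w1 scale1r.
move=> [z /=]; rewrite memv0 => /eqP -> <-; rewrite addr0.
exists 1%N, (fun=> x), (fun=> 1); split=> //; first by rewrite big_ord1.
by rewrite big_ord1 scale1r.
Qed.

Lemma crank1_eq (Z : {set T}) s t : rk Z = 1%N -> s \in Z -> t \in Z -> p s = p t.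
Proof.
move=> rZ sZ tZ; have [/vlineP[a sE]|sv] := boolP (v s \in <[v t]>%VS).
  have a1 : a = 1.
    have := lev_height (p s); rewrite -/(v s) sE /lev -scalemxAl mxE.
    by rewrite -/(lev _ _) lev_height mulr1.
  by move: sE; rewrite a1 scale1r => /eq_row_mx[].
have [g gs gt] := separation sv.
have : (rk [set t] < rk Z)%N.
  apply: (@crank_lt_lev _ _ _ _ g _ _ s) => //; last by rewrite sub1set.
  by move=> _ /set1P ->; apply: gt; exact: memv_line.
by rewrite rZ ltnS leqn0 crank_eq0 => /eqP/setP/(_ t); rewrite !inE eqxx.
Qed.

Lemma faces_vertices (Z : {set T}) t : Z \in L -> rk Z = 1%N -> t \in Z ->
  vertices (chull p [set: T]) (p t).
Proof.
move=> /polyfacesP FZ rZ tZ; apply/face_chull; exists Z => //.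
apply/seteqP; split=> [_ ->|x]; first exact: chull_pt.
move=> [w [w0 wZ w1 ->]] /=.
have pE s : s \in Z -> p s = p t by move=> sZ; exact: (crank1_eq rZ).
rewrite (eq_bigr (fun s => w s *: p t)) => [|s _].
  by rewrite -scaler_suml w1 scale1r.
by have [/pE->//|/wZ->] := boolP (s \in Z); rewrite !scale0r.
Qed.

Lemma card_vertices k : (vertices (chull p [set: T]) #= `I_k)%card ->
  #|lower L rk [set: T] 1| = k.
Proof.
move=> vk; apply: card_finset_eqII; apply: card_eq_trans vk.
pose f (x : 'rV[R]_N) := [set t | p t == x].
rewrite (_ : [set` lower _ _ _ _] = f @` vertices (chull p [set: T]))%classic.
  apply: inj_card_eq => x y; move=> /set_mem/vertices_faces[Z ZL [rZ _ ZE]] _ xy.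
  have /set0Pn[t tZ] : Z != set0 by rewrite -(crank_eq0 p) rZ.
  move: (tZ); rewrite ZE => /eqP <-; apply/eqP.
  have : t \in f y by rewrite -xy inE -ZE.
  by rewrite inE.
apply/seteqP; split=> [Z /setIdP[ZL /andP[_ /eqP rZ]]|_ [x /vertices_faces[Z ZL [rZ _ ZE]] <-]].
  have /set0Pn[t tZ] : Z != set0 by rewrite -(crank_eq0 p) rZ.
  have vt := faces_vertices ZL rZ tZ; exists (p t) => //.
  have [Y YL [rY _ YE]] := vertices_faces vt.
  have -> : f (p t) = Y by apply/setP => s; rewrite inE YE.
  apply/esym/(faces_eq ZL); last by rewrite rY rZ.
  by apply/subsetP => s sZ; rewrite YE; apply/eqP/(crank1_eq rZ).
have -> : f x = Z by apply/setP => t; rewrite inE ZE.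
by apply/setIdP; rewrite ZL subsetT rZ.
Qed.

(** Double count of incidences: by the diamond property every edge has two vertices and every vertex
    lies on two edges. *)
Lemma card_edges : rk [set: T] = 3%N ->
  #|lower L rk [set: T] 2| = #|lower L rk [set: T] 1|.
Proof.
move=> rT; apply/eqP; rewrite -(eqn_pmul2r (isT : 0 < 2)%N) -!sum_nat_const; apply/eqP.
have lowT r Y : (Y \in lower L rk [set: T] r) = (Y \in L) && (rk Y == r).
  by apply/setIdP/andP => [[-> /andP[_ ->]]|[-> ->]]; rewrite ?subsetT.
pose I (Z Y : {set T}) : nat := Z \subset Y.
transitivity (\sum_(Y in lower L rk [set: T] 2) \sum_(Z in lower L rk [set: T] 1) I Z Y)%N.
  apply: eq_bigr => Y; rewrite lowT => /andP[YL /eqP rY].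
  have := card_between YL set0_faces (sub0set Y).
  have /eqP -> : rk set0 == 0%N by rewrite crank_eq0.
  rewrite rY => /(_ erefl) <-; rewrite -sum1_card big_mkcond [RHS]big_mkcond /=.
  apply: eq_bigr => Z _; rewrite lowT /I.
  rewrite [Z \in [set _ in _ | _]]inE sub0set /=.
  by case: (Z \in L) => //=; case: (Z \subset Y); case: eqP.
rewrite exchange_big /=; apply: eq_bigr => Z; rewrite lowT => /andP[ZL /eqP rZ].
have := card_between setT_faces ZL (subsetT Z); rewrite rZ rT => /(_ erefl) E.
rewrite -[RHS]E -sum1_card big_mkcond [RHS]big_mkcond /=.
apply: eq_bigr => Y _; rewrite lowT /I.
rewrite [Y \in [set _ in _ | _]]inE subsetT /=.
by case: (Y \in L) => //=; case: (Z \subset Y); case: eqP.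
Qed.

End Faces.

Lemma multiplicial_polytope_polygon (P : set 'rV[R]_N) m :
  polygon (m + 3) P -> multiplicial_polytope P 3 m.
Proof.
move=> [/polytope_chull[T [p ->]] /has_dim_chull rT vP].
(* Proper faces are simplices. In rank 3 both [C(3,1) + m C(1,0)] and [C(3,2) + m C(1,1)] equal m+3,
   the number of vertices and of edges. *)
pose e (Z : {set T}) := if Z == [set: T] then m else 0%N.
exists T, p, e; split=> //; last by rewrite /e eqxx.
have c1 := card_vertices vP; have c2 := card_edges rT; rewrite c1 in c2.
move=> X XL; split.
- by rewrite lower0 cards1.
- move=> r; have [XT|nXT] := eqVneq X [set: T].
    subst X; rewrite /e eqxx rT; case: r => [|[|[|r]]].
    + by rewrite c1 muln1 addnC.
    + by rewrite c2 muln1 addnC.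
    + by rewrite -[in LHS]rT lower_rank ?setT_faces// cards1 muln0.
    + by rewrite lower_gt ?rT// cards0 muln0.
  have rX : (crank (fun t => homog (p t)) X < 3)%N.
    by rewrite -rT; apply: (crank_lt_faces XL); rewrite properEneq nXT subsetT.
  rewrite /e (negbTE nXT) mul0n addn0.
  have [lt|gt|rE] := ltngtP r.+1 (crank (fun t => homog (p t)) X).
  + have [r0 rX2] : r = 0%N /\ crank (fun t => homog (p t)) X = 2%N.
      by move: lt rX; clear; lia.
    have := card_between XL (set0_faces p) (sub0set X).
    have /eqP -> : crank (fun t => homog (p t)) set0 == 0%N by rewrite crank_eq0.
    rewrite rX2 r0 => /(_ erefl) E; rewrite -[RHS]E; apply: eq_card => Y.
    by apply/setIdP/setIdP => -[YL]; rewrite sub0set.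
  + by rewrite lower_gt// cards0 bin_small.
  + by rewrite rE lower_rank// cards1 binn.
- move=> r; have [XT|nXT] := eqVneq X [set: T].
    subst X; rewrite /e eqxx rT; case: r => [|r].
      rewrite -[in LHS]rT lower_rank ?setT_faces// big_set1 eqxx muln1 //.
    by rewrite lower_gt ?rT// big_set0 muln0.
  rewrite /e (negbTE nXT) mul0n lower_gt ?big_set0//.
  apply: (@leq_trans 3) => //; rewrite -rT.
  by apply: (crank_lt_faces XL); rewrite properEneq nXT subsetT.
- by rewrite /e; case: eqP => // ->; rewrite rT.
Qed.

End Polygons.

(** * Multiplexes *)

Lemma multiplicial_iso (T T' : finType) (L : {set {set T}}) (L' : {set {set T'}})
    rk rk' (V : {set T} -> {set T'}) e :
  (forall Z, Z \in L -> V Z \in L') ->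
  (forall X, X \in L' -> exists2 Z, Z \in L & V Z = X) ->
  (forall Y Z, Y \in L -> Z \in L -> (V Y \subset V Z) = (Y \subset Z)) ->
  (forall Z, Z \in L -> rk Z = rk' (V Z)) ->
  multiplicial L' rk' e -> multiplicial L rk (e \o V).
Proof.
move=> VL Vsurj Vsub Vrk mult X XL.
have inj r : {in lower L rk X r &, injective V}.
  move=> Y Z /setIdP[YL _] /setIdP[ZL _] YZ.
  by apply/eqP; rewrite eqEsubset -!Vsub// YZ subxx.
have imV r : V @: lower L rk X r = lower L' rk' (V X) r.
  apply/setP => Y; apply/imsetP/setIdP => [[Z /setIdP[ZL /andP[ZX rZ]] ->]|[YL /andP[YX rY]]].
    by rewrite VL// Vsub// ZX -Vrk.
  have [Z ZL ZY] := Vsurj Y YL; exists Z => //; apply/setIdP.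
  by rewrite ZL -Vsub// ZY YX Vrk// ZY.
have cardE r : #|lower L rk X r| = #|lower L' rk' (V X) r|.
  by rewrite -imV card_in_imset.
have [card0 cardX sumX e_gt0] := mult _ (VL X XL).
split=> [|r|r|]; rewrite ?cardE ?Vrk//.
by rewrite -sumX -imV big_imset.
Qed.

Lemma clampE n (j : int) : clamp n j = minn n `|Num.max j 0|%N :> nat.
Proof. by rewrite /clamp inordK// ltnS geq_minl. Qed.

Lemma clamp_adjacent d n (i : 'I_n.+1) : (1 < d)%N ->
  [set clamp n j | j in [set j : int | [/\ i%:Z - d%:Z + 1 <= j,
     j <= i%:Z + d%:Z - 1 & j != i%:Z]]]%classic =
  [set k : 'I_n.+1 | adjacent d n i k]%classic.
Proof.
move=> d2; have i_lt := ltn_ord i; apply/seteqP; split=> [_ [j /= [j1 j2 ji] <-]|k /= ik].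
  rewrite clampE /adjacent; case: j j1 j2 ji => m j1 j2 ji.
    rewrite max_l//= ; move: j1 j2 ji i_lt d2; clear; lia.
  rewrite max_r//= ; move: j1 j2 ji i_lt d2; clear; lia.
have k_lt := ltn_ord k.
have [ki|ki] := eqVneq (i : nat) k; last first.
  exists k%:Z; last by apply: val_inj; rewrite /= clampE max_l//=; move: k_lt; clear; lia.
  by split; move: ik ki; rewrite /adjacent; clear; lia.
(* As d >= 2, the index -1 is in the range for i = 0 and n+1 is in the range for i = n; clamping
   sends them back to 0 and n. *)
move: ik; rewrite /adjacent ki eqxx /= => /orP[k0|kn].
  exists (- 1); last by apply: val_inj; rewrite /= clampE max_r//= (eqP k0) minn0.
  by split; move: k0 ki d2; clear; lia.
exists (k%:Z + 1); last first.
  apply: val_inj; rewrite /= clampE max_l//=; move: kn; clear; lia.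
by split; move: ki d2; clear; lia.
Qed.

Section Multiplex.
Variables (R : realType) (N : nat).

(** Points of nonzero weight must lie on the hyperplane that meets P only in x. This shows that a
    facet given as a hull contains no vertices besides the listed ones. *)
Lemma vertex_conv (P A : set 'rV[R]_N) x : vertices P x -> (A `<=` P)%classic ->
  conv A x -> A x.
Proof.
move=> [c [b [Pb xE]]] AP [m [q [w [qA w0 w1 xq]]]].
have xb : (x *m c) 0 0 = b.
  have : [set x]%classic x by [].
  by rewrite xE => -[].
have qb i : 0 <= w i * (b - (q i *m c) 0 0).
  by rewrite mulr_ge0// subr_ge0 Pb//; exact/AP/qA.
have : \sum_i w i * (b - (q i *m c) 0 0) = 0.
  rewrite (eq_bigr (fun i => w i * b - (w i *: q i *m c) 0 0)) => [|i _]; last first.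
    by rewrite -scalemxAl [X in _ = _ - X]mxE mulrBr.
  rewrite sumrB -mulr_suml w1 mul1r -summxE -mulmx_suml -xq xb.
  by rewrite subrr.
move=> /eqP; rewrite psumr_eq0// => /allP H.
have [i wi] : exists i, w i != 0.
  apply/existsP; apply: contraTT isT; rewrite negb_exists => /forallP w_eq0.
  move: w1; rewrite big1 => [/esym/eqP|i _]; first by rewrite oner_eq0.
  by have := w_eq0 i; rewrite negbK => /eqP.
have := H i (mem_index_enum i); rewrite /= mulf_eq0 (negbTE wi) /= subr_eq0 => /eqP qib.
suff <- : q i = x by [].
have : (P `&` [set x | (x *m c) 0 0 = b])%classic (q i) by split=> //; exact/AP/qA.
by rewrite -xE.
Qed.

Variables (d n : nat) (d2 : (1 < d)%N) (dn : (d <= n)%N).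
Variables (T : finType) (p : T -> 'rV[R]_N) (x : 'I_n.+1 -> 'rV[R]_N).
Let v t := homog (p t).
Local Notation M := (chull p [set: T]).
Local Notation L := (polyfaces p).
Local Notation rk := (crank v).
Hypothesis rT : rk [set: T] = d.+1.
Hypothesis x_inj : injective x.
Hypothesis xM : vertices M = range x.
Hypothesis facetsM : faces_of_dim M d.-1 = range (fun i : 'I_n.+1 =>
  conv [set x (clamp n j) | j in [set j : int |
    [/\ i%:Z - d%:Z + 1 <= j, j <= i%:Z + d%:Z - 1 & j != i%:Z]]])%classic.

Definition vset (Z : {set T}) : {set 'I_n.+1} := [set j | `[< chull p Z (x j) >]].

Lemma vsetP (Z : {set T}) j : reflect (chull p Z (x j)) (j \in vset Z).
Proof. by rewrite inE; exact: asboolP. Qed.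

Lemma x_point j : exists t, x j = p t.
Proof.
have /vertices_faces[Z ZL [rZ ZE _]] : vertices M (x j) by rewrite xM; exists j.
have /set0Pn[t tZ] : Z != set0 by rewrite -(crank_eq0 p) rZ.
by exists t; have := chull_pt p tZ; rewrite ZE.
Qed.

Lemma x_in_M j : M (x j).
Proof. by have [t ->] := x_point j; apply: chull_pt. Qed.

(** A face Y not inside Z has a vertex outside Z, so faces are recovered, with their order, from
    their vertices. *)
Lemma vset_subset (Y Z : {set T}) : Y \in L -> Z \in L ->
  (vset Y \subset vset Z) = (Y \subset Z).
Proof.
move=> /polyfacesP FY /polyfacesP FZ; apply/idP/idP => [|YZ]; last first.
  by apply/subsetP => j /vsetP jY; apply/vsetP; exact: chullS jY.
apply: contraTT => /(coneface_vertex_notin (fun t => lev_height (p t)) FY FZ).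
move=> [W [FW WYZ /set0Pn[t tW] Wv]]; apply/subsetPn.
have tYZ := subsetP WYZ t tW; move: tYZ; rewrite inE => /andP[tZ tY].
have WL : W \in L by exact/polyfacesP.
have rW : rk W = 1%N.
  apply/eqP; rewrite eqn_leq; apply/andP; split.
    apply: leq_trans (_ : \dim <[v t]> <= _)%N; last by rewrite dim_vline leq_b1.
    apply/dimvS/cspan_sub => s sW; have -> : v s = v t := Wv s t sW tW.
    exact: memv_line.
  by rewrite lt0n crank_eq0; apply/set0Pn; exists t.
have : vertices M (p t) by exact: faces_vertices WL rW tW.
rewrite xM => -[j _ jt]; exists j; apply/vsetP; rewrite jt.
  exact: chull_pt.
by move/(chull_ptE t FZ); exact/negP.
Qed.

Lemma conv_mfacet (i j : 'I_n.+1) : conv [set x (clamp n j) | j in [set j : int |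
    [/\ i%:Z - d%:Z + 1 <= j, j <= i%:Z + d%:Z - 1 & j != i%:Z]]]%classic (x j) <->
  j \in mfacet d i.
Proof.
rewrite inE (_ : [set _ | _ in _]%classic =
  [set x k | k in [set k : 'I_n.+1 | adjacent d n i k]]%classic); last first.
  by rewrite -clamp_adjacent// image_comp.
split=> [|ij].
  move/(vertex_conv (P := M)) => [|_ [k _ <-]|k /= ik /x_inj <- //].
    by rewrite xM; exists j.
  exact: x_in_M.
exists 1%N, (fun=> x j), (fun=> 1); split=> //; first by move=> _; exists j.
  by rewrite big_ord1.
by rewrite big_ord1 scale1r.
Qed.

Lemma vset_facet (G : {set T}) : G \in L -> rk G = d ->
  exists i, vset G = mfacet d i.
Proof.
move=> /polyfacesP FG rG.
have : faces_of_dim M d.-1 (chull p G).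
  split; first by apply/face_chull; exists G.
  by apply/has_dim_chull; rewrite -/v rG prednK// ltnW.
rewrite facetsM => -[i _ Gi]; exists i; apply/setP => j.
by apply/vsetP/idP; rewrite -Gi => /conv_mfacet.
Qed.

Lemma facet_vset (i : 'I_n.+1) : exists2 G, G \in L & vset G = mfacet d i.
Proof.
have : faces_of_dim M d.-1 (conv [set x (clamp n j) | j in [set j : int |
    [/\ i%:Z - d%:Z + 1 <= j, j <= i%:Z + d%:Z - 1 & j != i%:Z]]])%classic.
  by rewrite facetsM; exists i.
move=> [/face_chull[G FG GE] _]; exists G; first exact/polyfacesP.
by apply/setP => j; apply/vsetP/idP; rewrite -GE => /conv_mfacet.
Qed.

(** By [coneface_facet] every point outside a face is cut off by a facet through that face, and the
    facets are the prescribed ones. *)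
Lemma vset_msets (Z : {set T}) : Z \in L -> vset Z \in msets d n.
Proof.
move=> ZL; have /polyfacesP FZ := ZL; apply/msetsP => j jZ.
have [t tj] := x_point j.
have tZ : t \notin Z by apply: contra jZ => tZ; apply/vsetP; rewrite tj; exact: chull_pt.
have [G [FG rG ZG tG]] := coneface_facet FZ (in_setT t) tZ.
have GL : G \in L by exact/polyfacesP.
have [i Gi] := vset_facet GL (succn_inj (etrans rG rT)).
exists i; rewrite -Gi; first by rewrite vset_subset.
by apply/negP => /vsetP; rewrite tj => /(chull_ptE t FG); exact/negP.
Qed.

Lemma vsetI (Y Z : {set T}) : Y \in L -> Z \in L ->
  Y :&: Z \in L /\ vset (Y :&: Z) = vset Y :&: vset Z.
Proof.
move=> /polyfacesP FY /polyfacesP FZ; have FI := conefaceI FY FZ.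
split; first exact/polyfacesP.
apply/setP => j; have [t tj] := x_point j; rewrite [RHS]inE.
apply/vsetP/andP; rewrite tj.
  move/(chull_ptE t FI); rewrite inE => /andP[tY tZ].
  by split; apply/vsetP; rewrite tj; exact: chull_pt.
move=> [/vsetP + /vsetP]; rewrite tj => /(chull_ptE t FY) tY /(chull_ptE t FZ) tZ.
by apply: chull_pt; rewrite inE tY.
Qed.

Lemma vsetT : vset [set: T] = [set: 'I_n.+1].
Proof. by apply/setP => j; rewrite [RHS]inE; apply/vsetP/x_in_M. Qed.

(** Faces are closed under intersection, compatibly with vertex sets; X comes from the intersection
    of all facets containing it. *)
Lemma vset_surj (X : {set 'I_n.+1}) : X \in msets d n ->
  exists2 Z, Z \in L & vset Z = X.
Proof.
move=> /msetsP XL.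
have meet (s : seq 'I_n.+1) : exists2 Z, Z \in L &
    vset Z = [set j | all (fun i => j \in mfacet d i) s].
  elim: s => [|i s [Z ZL ZE]].
    exists [set: T]; first exact: setT_faces.
    by rewrite vsetT; apply/setP => j; rewrite !inE.
  have [G GL GE] := facet_vset i; have [IL IE] := vsetI GL ZL.
  exists (G :&: Z) => //; rewrite IE GE ZE; apply/setP => j.
  by rewrite in_setI [RHS]inE /=; congr (_ && _); rewrite inE.
have [Z ZL ZE] := meet (enum [pred i | X \subset mfacet d i]).
exists Z => //; rewrite ZE; apply/setP => j; rewrite [LHS]inE.
apply/allP/idP => [H|jX i]; last by rewrite mem_enum => /subsetP; apply.
apply: contraT => /XL[i Xi ij]; have := H i; rewrite mem_enum.
by move=> /(_ Xi); rewrite (negbTE ij).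
Qed.

(* The strictly increasing geometric rank is squeezed by the saturated chains
   above and below. *)
Lemma crank_vset (Z : {set T}) : Z \in L -> rk Z = mrank d (vset Z).
Proof.
have gr := mgradedP d2 dn.
have proper_lt (Y W : {set T}) : Y \in L -> W \in L -> vset Y \proper vset W ->
    (rk Y < rk W)%N.
  move=> YL WL; rewrite properE !vset_subset// => YW.
  by apply: (crank_lt_faces YL); rewrite properE.
move=> ZL; apply/eqP; rewrite eqn_leq; apply/andP; split.
  have [k] := ubnP (n.+1 - #|vset Z|); elim: k Z ZL => // k IH Z ZL; rewrite ltnS => Zk.
  have [ZT|ZT] := eqVneq (vset Z) [set: 'I_n.+1].
    by rewrite ZT (mrank_setT gr) -rT; exact/crankS/subsetT.
  have [X [XL ZX rX]] := mrank_up gr (vset_msets ZL) ZT.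
  have [W WL WX] := vset_surj XL; subst X.
  rewrite -ltnS -rX; apply: leq_trans (proper_lt _ _ ZL WL ZX) _.
  apply: IH => //; apply: leq_trans Zk.
  have Wn : (#|vset W| <= n.+1)%N by rewrite -[X in (_ <= X)%N]card_ord max_card.
  by apply: ltn_sub2l (proper_card ZX); apply: leq_trans (proper_card ZX) Wn.
have [k] := ubnP (mrank d (vset Z)); elim: k Z ZL => // k IH Z ZL; rewrite ltnS => Zk.
have [Z0|Z0] := eqVneq (vset Z) set0.
  rewrite Z0; apply: leq_trans (_ : #|set0 : {set 'I_n.+1}| <= _)%N; last by rewrite cards0.
  by apply: (mrank_le gr); rewrite -Z0 vset_msets.
have [X [XL XZ rX]] := mrank_down gr (vset_msets ZL) Z0.
have [W WL WX] := vset_surj XL; subst X.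
rewrite rX; apply: leq_ltn_trans (proper_lt _ _ WL ZL XZ).
by apply: IH => //; rewrite -rX.
Qed.

Lemma multiplicial_vset :
  multiplicial L rk (@mexcess d n \o vset) /\
  (@mexcess d n \o vset) [set: T] = (n - d)%N.
Proof.
have gr := mgradedP d2 dn; split.
  apply: (multiplicial_iso vset_msets vset_surj vset_subset crank_vset).
  exact: msets_multiplicial gr.
by rewrite /= vsetT /mexcess (mrank_setT gr) cardsT card_ord subSS.
Qed.

End Multiplex.
End FaceLattices.

Local Open Scope ring_scope.

Theorem theorem2p2 (R : realType) (d n N : nat) (M : set 'rV[R]_N)
    (hd : (2 <= d)%N) (hn : (d <= n)%N) (hM : multiplex d n M) :
  (forall (N' : nat) (B Q : set 'rV[R]_N'),
     polygon (n - d + 3)%N B -> pyramid_iter (d - 2)%N B Q ->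
     forall S : {set 'I_d}, flag_vector M S = flag_vector Q S) /\
  (forall (S : {set 'I_d}) (s : seq nat),
     sorted ltn s -> s =i [seq nat_of_ord i | i in S] ->
     (flag_vector M S)%:R = flag_formula d n s).
Proof.
have multM : multiplicial_polytope M d.+1 (n - d).
  have [polyM dimM [x [x_inj xM facetsM]]] := hM.
  have [T [p pM]] := polytope_chull polyM; subst M.
  have rT := (has_dim_chull p _ d).1 dimM.
  have [mult multT] := multiplicial_vset hd hn rT x_inj xM facetsM.
  by exists T, p, (@mexcess d n \o vset p x).
split=> [N' B Q polyB pyrQ S|S s s_sorted sS]; last first.
  rewrite (flag_vector_multiplicial multM s_sorted sS) flag_formulaE//.
  by apply: sorted_ltn_rcons => // k; rewrite sS => /fintype.imageP[i _ ->]; exact: ltn_ord.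
have multQ : multiplicial_polytope Q d.+1 (n - d).
  (* The polygon has rank 3 and excess n-d; each pyramid raises the rank by one and keeps the
     excess. *)
  have -> : d.+1 = (3 + (d - 2))%N by lia.
  move: (d - 2)%N Q pyrQ => t; elim: t => [|t IHt] Q /=.
    by move=> ->; exact: multiplicial_polytope_polygon.
  move=> [P' /IHt multP']; rewrite addnS.
  exact: multiplicial_polytope_pyramid.
pose s := sort leq [seq nat_of_ord i | i in S].
have s_sorted : sorted ltn s.
  rewrite ltn_sorted_uniq_leq sort_uniq sort_sorted ?andbT; last exact: leq_total.
  by rewrite map_inj_uniq ?enum_uniq//; exact: val_inj.
have sS : s =i [seq nat_of_ord i | i in S] by exact: mem_sort.
rewrite (flag_vector_multiplicial multM s_sorted sS).
by rewrite (flag_vector_multiplicial multQ s_sorted sS).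
Qed.
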